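(* Let $r\ge 1$ and let $G\subset \mathbb{Z}_2^r$ be a subgroup containing $1^r=(1,\dots,1)$. Then $S_G$ (constructed below) is a simple $(r,r)$-framed algebra whose structure codes are $D_{S_G}=\Delta G$ and $C_{S_G}=(\Delta G)^\perp$.
   Context: Framed algebras. Let $\mathrm{IS}=\{0,\frac12,\frac1{16}\}$ with fusion rule $\star$ (values are subsets of $\mathrm{IS}$): $0\star h=h\star 0=\{h\}$, $\frac12\star\frac12=\{0\}$, $\frac12\star\frac1{16}=\frac1{16}\star\frac12=\{\frac1{16}\}$, $\frac1{16}\star\frac1{16}=\{0,\frac12\}$. For $h_0,\dots,h_3\in\mathrm{IS}$ put $A(h_0,h_1,h_2,h_3)=\{h\in\mathrm{IS}: h\in h_2\star h_3,\ h_0\in h_1\star h\}$. For $h\in A(h_0,h_1,h_2,h_3)$, $h'\in A(h_0,h_2,h_1,h_3)$ define $B^{h,h'}_{h_0,h_1,h_2,h_3}\in\mathbb{C}$ by: $B_{*,0,*,*}=B_{*,*,0,*}=1$; $B_{*,\frac12,\frac12,*}=-1$; $B_{a,\frac12,\frac1{16},a'}=B_{a,\frac1{16},\frac12,a'}=i$ if $a$ or $a'$ equals $\frac12$ and $-i$ otherwise; $B^{b,b'}_{a,\frac1{16},\frac1{16},a'}=e^{-\pi i/8}$ times: $1$ if $a,a'\neq\frac1{16}$, $a=a'$; $i$ if $a,a'\ne\frac1{16}$, $a\ne a'$; $\frac{1+i}2$ if $a=a'=\frac1{16}$, $b=b'$; $\frac{1-i}2$ if $a=a'=\frac1{16}$,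 $b\neq b'$ (upper indices are omitted when the sets $A$ are singletons). For $l,r\ge0$ let $\mathrm{IS}^{(l,r)}=\mathrm{IS}^l\times\mathrm{IS}^r$, $\lambda=(h_1,\dots,h_l,\bar h_1,\dots,\bar h_r)$, $s(\lambda)=\sum h_i-\sum\bar h_j$; extend $\star$, $A$ componentwise, and set $B^{\lambda,\lambda'}_{\lambda^0,\lambda^1,\lambda^2,\lambda^3}=\prod_{i=1}^l B^{h_i,h_i'}_{h^0_i,h^1_i,h^2_i,h^3_i}\prod_{j=1}^r\overline{B^{\bar h_j,\bar h_j'}_{\bar h^0_j,\bar h^1_j,\bar h^2_j,\bar h^3_j}}$ (complex conjugate on right components). An $(l,r)$-framed algebra is a finite-dimensional $\mathrm{IS}^{(l,r)}$-graded complex vector space $S=\bigoplus_\lambda S_\lambda$ with a bilinear product $\cdot$ and a nonzero $1\in S_0$ ($0=(0,\dots,0)$), writing $a\cdot_\lambda b$ for the $S_\lambda$-component of $a\cdot b$, such that: (FA1) $S_\lambda=0$ unless $s(\lambda)\in\mathbb{Z}$; (FA2) $S_0=\mathbb{C}1$ and $1\cdot a=a\cdot 1=a$; (FA3) $S_{\lambda^1}\cdot S_{\lambda^2}\subset\bigoplus_{\lambda\in\lambda^1\star\lambda^2}S_\lambda$; (FA4) for all $\lambda^0,\dots,\lambda^3$, $a_i\in S_{\lambda^i}$ ($i=1,2,3$), $\lambda'\in A(\lambda^0,\lambda^2,\lambda^1,\lambda^3)$: $a_2\cdot_{\lambda^0}(a_1\cdot_{\lambda'}a_3)=\sum_{\lambda\in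 A(\lambda^0,\lambda^1,\lambda^2,\lambda^3)}B^{\lambda,\lambda'}_{\lambda^0,\lambda^1,\lambda^2,\lambda^3}\,a_1\cdot_{\lambda^0}(a_2\cdot_\lambda a_3)$. An ideal is a graded subspace $M$ with $S\cdot M\subset M$; $S$ is simple if its only ideals are $0$ and $S$. Codes. Identify $\mathrm{IS}$ with $\{(d,c)\in\mathbb{Z}_2^2: dc=0\}$ via $0\leftrightarrow(0,0)$, $\frac12\leftrightarrow(0,1)$, $\frac1{16}\leftrightarrow(1,0)$, and componentwise $\mathrm{IS}^{(l,r)}$ with pairs $(d,c)\in\mathbb{Z}_2^{l+r}\times\mathbb{Z}_2^{l+r}$ with $dc=0$ (componentwise product); write $S_{d,c}$. For $c\in\mathbb{Z}_2^{l+r}$, $|c|_l$ ($|c|_r$) is the number of ones among the first $l$ (last $r$) coordinates and $|c|=|c|_l-|c|_r$. The structure codes are $C_S=\{\alpha: S_{(0,\alpha)}\ne0\}$ and $D_S=\{d:\bigoplus_cS_{d,c}\neq0\}$. For a subgroup $A$, $A^\perp=\{\beta:|\beta a|\in2\mathbb{Z}\ \forall a\in A\}$. Put $d_\perp=1^{l+r}+d$ and $\mathbb{Z}_2^d=\{\alpha:d\alpha=\alpha\}$. Construction of $S_G$ ($l=r$). $\Delta:\mathbb{Z}_2^r\to\mathbb{Z}_2^{r+r}$, $g\mapsto(g,g)$; $D_G=\Delta G$, $C_G=D_G^\perp$. Let $C^{\rm even}_{r,r}=\{\alpha:|\alpha|\in2\mathbb{Z}\}$ with ordered basis $(v_1,\dots,v_{2r-1})=(\Delta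 e_1,\dots,\Delta e_r,\tilde e_1-\tilde e_2,\dots,\tilde e_{r-1}-\tilde e_r)$, $\tilde e_i=(e_i,0)$, and let $\varepsilon$ be the bimultiplicative map $C^{\rm even}_{r,r}\times C^{\rm even}_{r,r}\to\{\pm1\}$ with $\varepsilon(v_i,v_i)=(-1)^{|v_i|/2}$, $\varepsilon(v_i,v_j)=1$ for $i<j$, $\varepsilon(v_i,v_j)=(-1)^{|v_iv_j|}$ for $i>j$. Let $\mathbb{C}[\hat C_G]$ have basis $e_\alpha$ ($\alpha\in C_G$), $e_\alpha e_\beta=\varepsilon(\alpha,\beta)e_{\alpha+\beta}$. For $d\in\Delta\mathbb{Z}_2^r$ let $\Delta^d=\mathbb{Z}_2^d\cap\Delta\mathbb{Z}_2^r$; $\{e_\gamma\}_{\gamma\in\Delta^d}$ spans a copy of the group algebra $\mathbb{C}[\Delta^d]$. For $d\in D_G$ let $A_G(d)=\mathbb{C}[\hat C_G]\otimes_{\mathbb{C}[\Delta^d]}\mathbb{C}t_d$ ($\mathbb{C}t_d$ the trivial module), $S_G=\bigoplus_{d\in D_G}A_G(d)$, with $e_\alpha\cdot t_d$ of degree $(d,d_\perp\alpha)$, unit $1=e_0\cdot t_0$, $\delta_d=\sum_{\gamma\in\Delta^d}e_\gamma$, and the (well-defined) product $(e_{\alpha^1}\cdot t_{d^1})\cdot(e_{\alpha^2}\cdot t_{d^2})=(-1)^{|d^1d^2_\perp\alpha^1\alpha^2|+|d^1d^2\alpha^2|+\frac12|d^1\alpha^2|}\,e_{\alpha^1}\delta_{d^1d^2}e_{\alpha^2}\cdot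 t_{d^1+d^2}$. *)

(* Defs.v *)
From HB Require Import structures.
From mathcomp Require Import all_boot all_order all_algebra.
Set Implicit Arguments. Unset Strict Implicit. Unset Printing Implicit Defensive.
Import Order.TTheory GRing.Theory Num.Theory.
Local Open Scope ring_scope.

(* The set IS = {0, 1/2, 1/16}                                          *)
Inductive IS := h0 | hhalf | h16.   (* 0, 1/2, 1/16 *)

Definition IS_to (h : IS) : 'I_3 :=
  match h with h0 => inord 0 | hhalf => inord 1 | h16 => inord 2 end.
Definition IS_of (i : 'I_3) : IS :=
  match val i with 0 => h0 | 1 => hhalf | _ => h16 end.
Lemma IS_toK : cancel IS_to IS_of.
Proof. by case; rewrite /IS_of /= inordK. Qed.
HB.instance Definition _ := Finite.copy IS (can_type IS_toK).

(* numerical value of h (a conformal weight) *)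
Definition hval (h : IS) : rat :=
  match h with h0 => 0 | hhalf => 1/2 | h16 => 1/16 end.

(* fusion rule *)
Definition star (a b : IS) : {set IS} :=
  match a, b with
  | h0, h => [set h]
  | h, h0 => [set h]
  | hhalf, hhalf => [set h0]
  | hhalf, h16 => [set h16]
  | h16, hhalf => [set h16]
  | h16, h16 => [set h0; hhalf]
  end.

(* A(h0,h1,h2,h3) *)
Definition Aset (a0 a1 a2 a3 : IS) : {set IS} :=
  [set h | (h \in star a2 a3) && (a0 \in star a1 h)].

(* e^{-pi i/8} = cos(pi/8) - i sin(pi/8) *)
Definition zeta16 (C : numClosedFieldType) : C :=
  sqrtC (2 + sqrtC 2) / 2 - 'i * (sqrtC (2 - sqrtC 2) / 2).

(* B^{b,b'}_{a0,a1,a2,a3} (a total function; only its values for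
   b \in A(a0,a1,a2,a3), b' \in A(a0,a2,a1,a3) matter) *)
Definition Bval (C : numClosedFieldType) (b b' a0 a1 a2 a3 : IS) : C :=
  match a1, a2 with
  | h0, _ => 1
  | _, h0 => 1
  | hhalf, hhalf => -1
  | hhalf, h16 | h16, hhalf =>
      if (a0 == hhalf) || (a3 == hhalf) then 'i else - 'i
  | h16, h16 =>
      zeta16 C *
      (if (a0 != h16) && (a3 != h16) then
         (if a0 == a3 then 1 else 'i)
       else if (a0 == h16) && (a3 == h16) then
         (if b == b' then (1 + 'i) / 2 else (1 - 'i) / 2)
       else 0)
  end.

(* IS^(l,r): functions on 'I_(l+r); indices i < l are left components,  *)
(* indices i >= l are right components.                                 *)
Notation lam l r := {ffun 'I_(l + r) -> IS}.

Definition lam0 (l r : nat) : lam l r := [ffun => h0].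

Definition sfun (l r : nat) (la : lam l r) : rat :=
  \sum_(i : 'I_(l + r) | (i < l)%N) hval (la i)
  - \sum_(i : 'I_(l + r) | (l <= i)%N) hval (la i).

Definition lstar (l r : nat) (la1 la2 : lam l r) : {set lam l r} :=
  [set la : lam l r | [forall i, la i \in star (la1 i) (la2 i)]].

Definition lA (l r : nat) (la0 la1 la2 la3 : lam l r) : {set lam l r} :=
  [set la : lam l r | [forall i, la i \in Aset (la0 i) (la1 i) (la2 i) (la3 i)]].

Definition lB (C : numClosedFieldType) (l r : nat)
    (la la' la0 la1 la2 la3 : lam l r) : C :=
  \prod_(i : 'I_(l + r))
     (if (i < l)%N
      then Bval C (la i) (la' i) (la0 i) (la1 i) (la2 i) (la3 i)
      else (Bval C (la i) (la' i) (la0 i) (la1 i) (la2 i) (la3 i))^*).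

(* Framed algebras                                                      *)
(* A finite-dimensional IS^(l,r)-graded vector space with a product and
   a unit: the carrier is a vectType (finite dimensional), the grading is
   a family of subspaces S_la, the product and the unit are data.      *)
Record gr_alg (C : fieldType) (vT : vectType C) (l r : nat) := GrAlg {
  gcomp : lam l r -> {vspace vT};
  gmul : vT -> vT -> vT;
  gone : vT }.

(* the la-component of v (projection onto S_la along the other S_mu) *)
Definition gproj (C : fieldType) (vT : vectType C) (l r : nat)
    (S : gr_alg vT l r) (la : lam l r) (v : vT) : vT :=
  daddv_pi (gcomp S la) (\sum_(mu | mu != la) gcomp S mu)%VS v.

(* a .la b *)
Definition gmul_at (C : fieldType) (vT : vectType C) (l r : nat)
    (S : gr_alg vT l r) (la : lam l r) (a b : vT) : vT :=
  gproj S la (gmul S a b).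

Definition framed_algebra (C : numClosedFieldType) (vT : vectType C)
    (l r : nat) (S : gr_alg vT l r) : Prop :=
  (* graded vector space: S = (+)_la S_la *)
  (directv (\sum_(la : lam l r) gcomp S la)%VS
   /\ (\sum_(la : lam l r) gcomp S la)%VS = fullv)
  (* bilinear product *)
  /\ (forall (k : C) (a b c : vT),
        gmul S (k *: a + b) c = k *: gmul S a c + gmul S b c
        /\ gmul S c (k *: a + b) = k *: gmul S c a + gmul S c b)
  (* FA1 *)
  /\ (forall la : lam l r, sfun la \notin Num.int -> gcomp S la = 0%VS)
  (* FA2 *)
  /\ (gone S != 0 /\ gcomp S (lam0 l r) = <[gone S]>%VS
      /\ forall a, gmul S (gone S) a = a /\ gmul S a (gone S) = a)
  (* FA3 *)
  /\ (forall (la1 la2 : lam l r) (a b : vT),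
        a \in gcomp S la1 -> b \in gcomp S la2 ->
        gmul S a b \in (\sum_(la in lstar la1 la2) gcomp S la)%VS)
  (* FA4 *)
  /\ (forall (la0 la1 la2 la3 : lam l r) (a1 a2 a3 : vT) (la' : lam l r),
        a1 \in gcomp S la1 -> a2 \in gcomp S la2 -> a3 \in gcomp S la3 ->
        la' \in lA la0 la2 la1 la3 ->
        gmul_at S la0 a2 (gmul_at S la' a1 a3)
        = \sum_(la in lA la0 la1 la2 la3)
             lB C la la' la0 la1 la2 la3 *: gmul_at S la0 a1 (gmul_at S la a2 a3)).

(* ideals: graded subspaces M with S.M \subset M *)
Definition is_ideal (C : fieldType) (vT : vectType C) (l r : nat)
    (S : gr_alg vT l r) (M : {vspace vT}) : Prop :=
  M = (\sum_(la : lam l r) (M :&: gcomp S la))%VS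
  /\ (forall a m : vT, m \in M -> gmul S a m \in M).

Definition simple_alg (C : fieldType) (vT : vectType C) (l r : nat)
    (S : gr_alg vT l r) : Prop :=
  forall M : {vspace vT}, is_ideal S M -> M = 0%VS \/ M = fullv.

(* Codes                                                                *)
Notation F2v n := 'rV['F_2]_n.

(* identification IS <-> {(d,c) | dc = 0} *)
Definition ISd (h : IS) : 'F_2 := if h == h16 then 1 else 0.
Definition ISc (h : IS) : 'F_2 := if h == hhalf then 1 else 0.
Definition dvec (l r : nat) (la : lam l r) : F2v (l + r) := \row_i ISd (la i).
Definition cvec (l r : nat) (la : lam l r) : F2v (l + r) := \row_i ISc (la i).

(* componentwise product *)
Definition hprod (n : nat) (a b : F2v n) : F2v n := \row_i (a 0 i * b 0 i).

(* |c| = |c|_l - |c|_r *)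
Definition wt (l r : nat) (c : F2v (l + r)) : int :=
  (#|[set i : 'I_(l + r) | (i < l)%N && (c 0 i != 0)]|%:Z
   - #|[set i : 'I_(l + r) | (l <= i)%N && (c 0 i != 0)]|%:Z)%R.
Arguments wt : clear implicits.

Definition perp (l r : nat) (A : {set F2v (l + r)}) : {set F2v (l + r)} :=
  [set be | [forall a in A, (2 %| wt l r (hprod be a))%Z]].
Arguments perp : clear implicits.

Definition code_C (C : fieldType) (vT : vectType C) (l r : nat)
    (S : gr_alg vT l r) : {set F2v (l + r)} :=
  [set al | [exists la : lam l r,
     [&& dvec la == 0, cvec la == al & gcomp S la != 0%VS]]].

Definition code_D (C : fieldType) (vT : vectType C) (l r : nat)
    (S : gr_alg vT l r) : {set F2v (l + r)} :=
  [set d | [exists la : lam l r, (dvec la == d) && (gcomp S la != 0%VS)]].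

(* Construction of S_G (l = r)                                          *)
Definition Delta (r : nat) (g : F2v r) : F2v (r + r) := row_mx g g.

Definition D_G (r : nat) (G : {set F2v r}) : {set F2v (r + r)} := @Delta r @: G.
Definition C_G (r : nat) (G : {set F2v r}) : {set F2v (r + r)} :=
  perp r r (D_G G).

Definition dperp (n : nat) (d : F2v n) : F2v n := const_mx 1 + d.

(* sign (-1)^z *)
Definition sgnZ (C : numClosedFieldType) (z : int) : C :=
  if odd `|z|%N then -1 else 1.

(* unit vector e_k (k a natural number index) *)
Definition unitv (n k : nat) : F2v n := \row_(j < n) (if (j == k :> nat) then 1 else 0).

(* ordered basis (v_1,...,v_{2r-1}) of C^even_{r,r}, 0-based:
   v_k = Delta e_k for k < r, v_{r+k} = e~_k - e~_{k+1} for k < r-1 *)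
Definition vb (r : nat) (k : 'I_(r.*2.-1)) : F2v (r + r) :=
  if (k < r)%N then Delta (unitv r k)
  else row_mx (unitv r (k - r) - unitv r (k - r).+1) 0.

(* epsilon on basis vectors *)
Definition eps_b (C : numClosedFieldType) (r : nat) (i j : 'I_(r.*2.-1)) : C :=
  if i == j then sgnZ C ((wt r r (vb i)) %/ 2)%Z
  else if (i < j)%N then 1
  else sgnZ C (wt r r (hprod (vb i) (vb j))).

(* coordinates in the basis (v_k) *)
Definition coords (r : nat) (al : F2v (r + r)) : 'rV['F_2]_(r.*2.-1) :=
  odflt 0 [pick a : 'rV['F_2]_(r.*2.-1) | al == \sum_k a 0 k *: vb k].

(* the bimultiplicative map epsilon *)
Definition eps (C : numClosedFieldType) (r : nat) (al be : F2v (r + r)) : C :=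
  \prod_(i : 'I_(r.*2.-1)) \prod_(j : 'I_(r.*2.-1))
     (if (coords al 0 i * coords be 0 j == 1) then eps_b C i j else 1).

(* Delta^d *)
Definition Deltad (r : nat) (d : F2v (r + r)) : {set F2v (r + r)} :=
  [set ga | (hprod d ga == ga) && (ga \in @Delta r @: [set: F2v r])].

(* free vector space on the symbols e_al . t_d, indexed by pairs (d, al) *)
Definition SGidx (r : nat) := (F2v (r + r) * F2v (r + r))%type.
Definition Vfree (C : numClosedFieldType) (r : nat) := {ffun SGidx r -> C^o}.

Definition ev (C : numClosedFieldType) (r : nat) (p : SGidx r) : Vfree C r :=
  [ffun q => if q == p then 1 else 0].

(* span of the e_al . t_d, d in D_G, al in C_G *)
Definition Wsp (C : numClosedFieldType) (r : nat) (G : {set F2v r})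
  : {vspace Vfree C r} :=
  <<[seq ev C p | p <- enum [set p : SGidx r | (p.1 \in D_G G) && (p.2 \in C_G G)]]>>%VS.

(* relations of the tensor product over C[Delta^d]:
   (e_al e_ga) . t_d = e_al . t_d, i.e. eps(al,ga) e_(al+ga).t_d = e_al.t_d *)
Definition Ksp (C : numClosedFieldType) (r : nat) (G : {set F2v r})
  : {vspace Vfree C r} :=
  <<([seq ev C (p.1.1, p.1.2) - eps C p.1.2 p.2 *: ev C (p.1.1, p.1.2 + p.2)
      | p <- enum [set p : SGidx r * F2v (r + r) |
                  [&& p.1.1 \in D_G G, p.1.2 \in C_G G & p.2 \in Deltad p.1.1]]])%R>>%VS.

(* the quotient W/K, realised as the complement W :\: K of K in W,
   with quotient map the projection onto W :\: K along K *)
Definition SGspace (C : numClosedFieldType) (r : nat) (G : {set F2v r}) :=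
  subvs_of (Wsp C G :\: Ksp C G)%VS.

Definition SGpi (C : numClosedFieldType) (r : nat) (G : {set F2v r})
    (v : Vfree C r) : SGspace C G :=
  vsproj (Wsp C G :\: Ksp C G)%VS (addv_pi1 (Wsp C G) (Ksp C G) v).

(* product of two symbols, computed in the free space:
   (e_a1.t_d1)(e_a2.t_d2) = sign * e_a1 delta_(d1d2) e_a2 . t_(d1+d2) *)
Definition bprod (C : numClosedFieldType) (r : nat) (p q : SGidx r) : Vfree C r :=
  let: (d1, a1) := p in let: (d2, a2) := q in
  sgnZ C (wt r r (hprod (hprod d1 (dperp d2)) (hprod a1 a2))
          + wt r r (hprod (hprod d1 d2) a2)
          + (wt r r (hprod d1 a2) %/ 2)%Z) *:
  \sum_(ga in Deltad (hprod d1 d2))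
     (eps C a1 ga * eps C (a1 + ga) a2) *: ev C (d1 + d2, a1 + ga + a2).

Definition mulV (C : numClosedFieldType) (r : nat) (f g : Vfree C r) : Vfree C r :=
  \sum_(p : SGidx r) \sum_(q : SGidx r) ((f p : C) * (g q : C)) *: bprod C p q.

Definition S_G (C : numClosedFieldType) (r : nat) (G : {set F2v r})
  : gr_alg (SGspace C G) r r :=
  {| gcomp := fun la : lam r r =>
       <<[seq SGpi G (ev C p)
         | p <- enum [set p : SGidx r | [&& p.1 \in D_G G, p.2 \in C_G G,
                                          p.1 == dvec la
                                        & hprod (dperp p.1) p.2 == cvec la]]]>>%VS;
     gmul := fun x y => SGpi G (mulV (vsval x) (vsval y));
     gone := SGpi G (ev C (0, 0)) |}.

(* Main.v *)
Require Import Defs.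
From HB Require Import structures.
From mathcomp Require Import all_boot all_order all_algebra.
From mathcomp Require Import ring zify.
Import Order.TTheory GRing.Theory Num.Theory.
Local Open Scope ring_scope.
Set Implicit Arguments.
Unset Strict Implicit.
Unset Printing Implicit Defensive.
(**
The vectors bas (d, a), the classes of e_a . t_d, span S_G and satisfy
bas (d, a + g) = (-1)^|a g| bas (d, a) for g in Delta^d; a product of two of
them is a scalar times the sum of (-1)^|a1 g| bas (d1 + d2, a1 + a2 + g) over g
in Delta^(d1 d2).  Both sides of (FA4) are therefore sums, over diagonal vectors x
supported where at least two of d1, d2, d3 are 1, of scalars times
bas (d1 + d2 + d3, a1 + a2 + a3 + x).  The x contributing in a fixed degree
differ by elements of Delta^(d1 + d2 + d3), so all these vectors are
proportional.  The values of epsilon contribute a common factor and signs, and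
every remaining sign or power of i, as well as B, is a product over coordinates.
The sum of products is a product over k < r of sums over the bit x_k, and (FA4)
reduces to an identity in Z[i] involving one left and one right coordinate,
which is decided by evaluation.
Simplicity holds because, up to a nonzero factor, the degree-0 component of
bas (d, a) . m is the coefficient of bas (d, a) in m.
*)

(** * Binary vectors and weights *)

Section Bits.

(** Two ingredients of the product are not products over coordinates. The sign (-1)^(|d1 a2| / 2) is
    replaced by i^|d1 a2|, which becomes such a product once right coordinates are conjugated; the
    two agree because a2 is orthogonal to D_G. The cocycle sees its arguments through prefix sums,
    so it has to be removed before any local argument: listing the diagonal basis vectors first
    makes it trivial on a diagonal left argument, and its commutator (-1)^|a b| then gives its value
    on a diagonal right argument. In (FA4) a left coordinate cannot be separated from its right
    partner: they share the d-bits and the summation bit x_k, and the constants e^(-pi i/8) cancel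
    only between the two. As the vectors in one degree are merely proportional, all of them are
    compared with one reference index; the sign of this comparison is again a product over
    coordinates, so the local identity carries an additional reference bit e. *)

Definition bit (n : nat) (v : F2v n) (i : 'I_n) : bool := v 0 i != 0.

Lemma F2_bit (x : 'F_2) : x = (x != 0)%:R.
Proof. by case: x => [[|[|m]] Hm]; apply/val_inj. Qed.

Lemma bitP n (u v : F2v n) : (forall i, bit u i = bit v i) -> u = v.
Proof.
move=> E; apply/rowP=> i.
by rewrite (F2_bit (u 0 i)) (F2_bit (v 0 i)) -/(bit u i) -/(bit v i) E.
Qed.

Lemma bitD n (u v : F2v n) i : bit (u + v) i = bit u i (+) bit v i.
Proof.
rewrite /bit mxE (F2_bit (u 0 i)) (F2_bit (v 0 i)).
by case: (u 0 i != 0); case: (v 0 i != 0).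
Qed.

Lemma bitM n (u v : F2v n) i : bit (hprod u v) i = bit u i && bit v i.
Proof. by rewrite /bit mxE mulf_eq0 negb_or. Qed.

Lemma bit0 n i : bit (0 : F2v n) i = false.
Proof. by rewrite /bit mxE eqxx. Qed.

Lemma bit1 n i : bit (const_mx 1 : F2v n) i.
Proof. by rewrite /bit mxE oner_eq0. Qed.

Lemma bit_dperp n (u : F2v n) i : bit (dperp u) i = ~~ bit u i.
Proof. by rewrite bitD bit1. Qed.

Lemma bit_row_mxl m n (u : F2v m) (v : F2v n) k :
  bit (row_mx u v) (lshift n k) = bit u k.
Proof. by rewrite /bit row_mxEl. Qed.

Lemma bit_row_mxr m n (u : F2v m) (v : F2v n) k :
  bit (row_mx u v) (rshift m k) = bit v k.
Proof. by rewrite /bit row_mxEr. Qed.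

Lemma addF2vv n (u : F2v n) : u + u = 0.
Proof. by apply: bitP => i; rewrite bitD addbb bit0. Qed.

Lemma addF2vK n (u v : F2v n) : u + v + v = u.
Proof. by rewrite -addrA addF2vv addr0. Qed.

Lemma oppF2v n (u : F2v n) : - u = u.
Proof. by apply/eqP; rewrite eq_sym -addr_eq0 addF2vv. Qed.

Definition bitE := (bitD, bitM, bit0, bit1, bit_dperp).

End Bits.

Ltac bits :=
  rewrite ?bitE; do ?[case: (bit _ _)] => //.

Section Weights.
Variables (C : numClosedFieldType) (r : nat).
Implicit Types (u v : F2v (r + r)).

(** Right coordinates carry conjugates, as in [lB]. With this twist i^|v|, for the difference weight
    |v|, is a product over coordinates. *)
Definition cj (i : 'I_(r + r)) (z : C) : C := if (i < r)%N then z else z^*.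

Lemma cjM i : {morph cj i : x y / x * y}.
Proof. by move=> x y; rewrite /cj; case: ifP => // _; rewrite rmorphM. Qed.

Lemma cj1 i : cj i 1 = 1.
Proof. by rewrite /cj rmorph1 if_same. Qed.

Lemma cj0 i : cj i 0 = 0.
Proof. by rewrite /cj rmorph0 if_same. Qed.

(* The sign (-1)^|v| and the power i^|v|, written as products over coordinates. *)
Definition sg v : C := \prod_i cj i (if bit v i then -1 else 1).

Definition ipow v : C := \prod_i cj i (if bit v i then 'i else 1).

Lemma odd_absD (m n : int) : odd (absz (m + n)) = odd (absz m) (+) odd (absz n).
Proof. lia. Qed.

Lemma sgnZD (m n : int) : sgnZ C (m + n) = sgnZ C m * sgnZ C n.
Proof.
rewrite /sgnZ odd_absD.
by case: (odd (absz m)); case: (odd (absz n)) => /=; rewrite ?mulN1r ?mulr1 ?mul1r ?opprK.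
Qed.

Lemma wt_count v : wt r r v =
  (\sum_(i < r) bit v (lshift r i))%N%:Z - (\sum_(i < r) bit v (rshift r i))%N%:Z.
Proof.
rewrite /wt; congr (_%:Z - _%:Z).
  rewrite -sum1_card big_mkcond big_split_ord /= [X in (_ + X)%N]big1 ?addn0.
    by apply: eq_bigr => i _; rewrite inE /= ltn_ord /bit; case: (_ != 0).
  by move=> i _; rewrite inE /= ltnNge leq_addr.
rewrite -sum1_card big_mkcond big_split_ord /= [X in (X + _)%N]big1 ?add0n.
  by apply: eq_bigr => i _; rewrite inE /= leq_addr /bit; case: (_ != 0).
by move=> i _; rewrite inE /= leqNgt ltn_ord.
Qed.

Lemma prod_bit (I : finType) (x : C) (f : I -> bool) :
  \prod_i (if f i then x else 1) = x ^+ (\sum_i f i)%N.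
Proof.
rewrite -prodrXr; apply: eq_bigr => i _.
by case: (f i).
Qed.

Lemma prod_cj (F : 'I_(r + r) -> C) :
  \prod_i cj i (F i) = \prod_(k < r) (F (lshift r k) * (F (rshift r k))^*).
Proof.
rewrite big_split_ord big_split /=; congr (_ * _); apply: eq_bigr => k _.
  by rewrite /cj /= ltn_ord.
by rewrite /cj /= ltnNge leq_addr.
Qed.

Lemma sgnZ_wt v : sgnZ C (wt r r v) = sg v.
Proof.
rewrite wt_count /sg prod_cj big_split /= prod_bit.
under [X in _ * X]eq_bigr => k _ do
  rewrite (fun_if (fun z : C => z^*)) rmorphN1 rmorph1.
rewrite prod_bit -signr_odd -(signr_odd _ (\sum_(i < r) bit v (rshift _ _))%N) /sgnZ.
set m := (\sum_(i < r) bit v (lshift r i))%N; set n := (\sum_(i < r) bit v (rshift r i))%N.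
have -> : odd (absz (m%:Z - n%:Z)) = odd m (+) odd n by lia.
by case: (odd m); case: (odd n) => /=; rewrite ?expr0 ?expr1 ?mulN1r ?mulr1 ?mul1r ?opprK.
Qed.

Lemma sgnZ_half v : (2 %| wt r r v)%Z -> sgnZ C (wt r r v %/ 2)%Z = ipow v.
Proof.
rewrite wt_count /ipow prod_cj big_split /= prod_bit.
under [X in _ * X]eq_bigr => k _ do
  rewrite (fun_if (fun z : C => z^*)) conjCi rmorph1.
rewrite prod_bit.
set m := (\sum_(i < r) bit v (lshift r i))%N.
set n := (\sum_(i < r) bit v (rshift r i))%N => mn.
(* [m] and [n] have the same parity, so at most one factor i * (-i) = 1 is left over beside the even
   powers. *)
pose q := n./2; have En : n = (odd n + q.*2)%N by rewrite odd_double_half.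
pose p := m./2; have Em : m = (odd n + p.*2)%N by rewrite /p; lia.
have -> : ((m%:Z - n%:Z) %/ 2)%Z = p%:Z - q%:Z by lia.
have -> : sgnZ C (p%:Z - q%:Z) = (-1) ^+ p * (-1) ^+ q.
  rewrite sgnZD -(signr_odd _ p) -(signr_odd _ q) /sgnZ abszN !absz_nat.
  by case: (odd p); case: (odd q).
rewrite Em {2}En !exprD -!mul2n !exprM sqrrN sqrCi.
have : ('i : C) * - 'i = 1 by rewrite mulrN -expr2 sqrCi opprK.
by case: (odd n) => /= H; rewrite ?expr1 ?expr0; [rewrite mulrACA H | ]; rewrite !mul1r.
Qed.

Lemma sgD u v : sg (u + v) = sg u * sg v.
Proof.
rewrite -big_split /=; apply: eq_bigr => i _; rewrite -cjM bitD.
by do 2!case: (bit _ _); rewrite ?mulN1r ?mulr1 ?mul1r ?opprK.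
Qed.

Lemma sg0 : sg 0 = 1.
Proof. by rewrite /sg big1 // => i _; rewrite bit0 cj1. Qed.

Lemma sg_sqr u : sg u * sg u = 1.
Proof. by rewrite -sgD addF2vv sg0. Qed.

Lemma sg_pm u : (sg u == 1) || (sg u == -1).
Proof. by rewrite -sgnZ_wt /sgnZ; case: ifP; rewrite eqxx ?orbT. Qed.

Lemma sg_even v : (2 %| wt r r v)%Z = (sg v == 1).
Proof.
rewrite -sgnZ_wt /sgnZ.
have -> : (2 %| wt r r v)%Z = ~~ odd (absz (wt r r v)) by lia.
case: (odd _) => /=; last by rewrite eqxx.
by apply/esym/negbTE; rewrite -subr_eq0 -opprD oppr_eq0 -(natrD _ 1 1) pnatr_eq0.
Qed.

Lemma sg_Delta (g : F2v r) : sg (Delta g) = 1.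
Proof.
rewrite /sg prod_cj big1 // => k _.
rewrite bit_row_mxl bit_row_mxr; case: (bit _ _); last by rewrite rmorph1 mulr1.
by rewrite rmorphN1 mulN1r opprK.
Qed.

Lemma ipowD u v : ipow (u + v) = ipow u * ipow v * sg (hprod u v).
Proof.
rewrite -!big_split /=; apply: eq_bigr => i _; rewrite -!cjM !bitE; congr cj.
do 2!case: (bit _ _); rewrite ?mul1r ?mulr1 //.
by rewrite -expr2 sqrCi mulN1r opprK.
Qed.

Lemma ipow0 : ipow 0 = 1.
Proof. by rewrite /ipow big1 // => i _; rewrite bit0 cj1. Qed.

Lemma ipow_Delta (g : F2v r) : ipow (Delta g) = 1.
Proof.
rewrite /ipow prod_cj big1 // => k _.
rewrite bit_row_mxl bit_row_mxr; case: (bit _ _); last by rewrite rmorph1 mulr1.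
by rewrite conjCi mulrN -expr2 sqrCi opprK.
Qed.

Lemma ipow_neq0 v : ipow v != 0.
Proof.
rewrite /ipow prodf_seq_neq0; apply/allP=> i _ /=; rewrite /cj.
by case: ifP => _; rewrite ?conjC_eq0; case: ifP; rewrite ?neq0Ci ?oner_eq0.
Qed.

End Weights.

(** * The cocycle epsilon *)

Section Eps.
Variables (C : numClosedFieldType) (r : nat).
Hypothesis r_gt0 : (0 < r)%N.
Implicit Types (u v a b : F2v (r + r)).
Local Notation sg := (@sg C r).
Local Notation eps := (@eps C r).
Local Notation m := (r.*2.-1).

Definition vb_mx : 'M['F_2]_(m, r + r) := \matrix_k vb k.

(* A right inverse of vb_mx: coordinate k < r of (x, y) is y_k, and coordinate
   r + k is the prefix sum of x + y up to index k. *)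
Definition coord_mx : 'M['F_2]_(r + r, m) :=
  col_mx (\matrix_(j, l) (if (l < r)%N then 0 else (j <= l - r)%N%:R))
         (\matrix_(j, l) (if (l < r)%N then (j == l :> nat)%:R else (j <= l - r)%N%:R)).

Lemma sum_delta n (F : nat -> 'F_2) (k : nat) : (k < n)%N ->
  \sum_(j < n) unitv n k 0 j * F j = F k.
Proof.
move=> kn; rewrite (bigD1 (Ordinal kn)) //= mxE /= eqxx mul1r big1 ?addr0 // => j nj.
by rewrite mxE ifN ?mul0r.
Qed.

Lemma vb_coord : vb_mx *m coord_mx = 1%:M.
Proof.
apply/matrixP=> k l; rewrite -[vb_mx]hsubmxK mul_row_col !mxE.
have lt k' : (k' < m)%N -> ~~ (k' < r)%N -> ((k' - r).+1 < r)%N by lia.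
case: (ltnP k r) => kr.
  under eq_bigr => j _ do rewrite !mxE /vb kr row_mxEl.
  under [X in _ + X]eq_bigr => j _ do rewrite !mxE /vb kr row_mxEr.
  rewrite (sum_delta (fun j => if (l < r)%N then 0 else (j <= l - r)%N%:R)) //.
  rewrite (sum_delta (fun j => if (l < r)%N then (j == l :> nat)%:R else (j <= l - r)%N%:R)) //.
  case: (ltnP l r) => lr; first by rewrite add0r.
  have -> : (k == l) = false by apply/negP=> /eqP E; rewrite E ltnNge lr in kr.
  by case: (_ <= _)%N; apply/val_inj.
have kr' : (k < r)%N = false by lia.
have k2 : ((k - r).+1 < r)%N by apply: lt => //; rewrite kr'.

(* For [l >= r] the difference of two consecutive prefix indicators is nonzero exactly at
   [l = k]. *)
pose F j : 'F_2 := if (l < r)%N then 0 else (j <= l - r)%N%:R.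
transitivity (F (k - r)%N - F (k - r).+1).
  rewrite -(sum_delta F (ltnW k2)) -(sum_delta F k2) -sumrB [X in _ + X]big1 => [|j _].
    rewrite addr0; apply: eq_bigr => j _.
    by rewrite !mxE /vb kr' row_mxEl !mxE -mulrBl.
  by rewrite !mxE /vb kr' row_mxEr mxE mul0r.
rewrite /F -val_eqE /=; case: (ltnP l r) => lr.
  by rewrite subr0; case: eqP => // E; lia.
case: eqP => [E|E].
  by rewrite E leqnn ltnn subr0.
have -> : ((k - r).+1 <= l - r)%N = (k - r <= l - r)%N by lia.
by rewrite subrr.
Qed.

Lemma sg_sum v : sg v = if \sum_i v 0 i == 0 then 1 else -1.
Proof.
pose f (x : 'F_2) : C := if x == 0 then 1 else -1.
have f0 : f 0 = 1 by rewrite /f eqxx.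
have f1 : {morph f : x y / x + y >-> x * y}.
  move=> x y; rewrite (F2_bit x) (F2_bit y) /f.
  by case: (x != 0); case: (y != 0); rewrite /= ?mulN1r ?mulr1 ?mul1r ?opprK.
rewrite -/(f _) (big_morph f f1 f0); apply: eq_bigr => i _; rewrite /f.
by rewrite /cj /bit if_neg; case: (_ == 0); rewrite ?rmorph1 ?rmorphN1 if_same.
Qed.

(** The first [r] columns kill the right half, the others the prefix sums of the left half of length
    below [r]. The full sum is not a coordinate; it vanishes by evenness. Differences of prefix sums
    then give the entries. This injectivity makes the right inverse two-sided on even vectors. *)
Lemma even_coord0 v : sg v = 1 -> v *m coord_mx = 0 -> v = 0.
Proof.
move=> ev v0.
have c l : (v *m coord_mx) 0 l = 0 by rewrite v0 mxE.
have y0 (j : 'I_r) : v 0 (rshift r j) = 0.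
  have jm : (j < m)%N by have := ltn_ord j; lia.
  have := c (Ordinal jm); rewrite mxE big_split_ord /= big1 => [|i _].
    rewrite add0r (bigD1 j) //= big1 => [|i ij].
      by rewrite addr0 col_mxEd mxE /= ltn_ord eqxx mulr1.
    by rewrite col_mxEd mxE /= ltn_ord (_ : (_ == _ :> nat) = false) ?mulr0 //; apply/negbTE.
  by rewrite col_mxEu mxE /= ltn_ord mulr0.
pose S k := \sum_(j < r | (j < k)%N) v 0 (lshift r j).
have S0 k : (k <= r)%N -> S k = 0.
  rewrite leq_eqVlt => /predU1P[-> | kr].
    have : sg v != -1 by rewrite ev -subr_eq0 opprK -(natrD _ 1 1) pnatr_eq0.
    rewrite sg_sum; case: (\sum_i v 0 i =P 0) => [E _ | _]; last by rewrite eqxx.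
    rewrite -[RHS]E big_split_ord /= [X in _ + X]big1 ?addr0 /S.
      by apply: eq_bigl => j; rewrite ltn_ord.
    by move=> j _; rewrite y0.
  case: k kr => [|k] kr; first by rewrite /S big1.
  have km : (r + k < m)%N by lia.
  have := c (Ordinal km); rewrite mxE big_split_ord /= [X in _ + X]big1 => [|i _]; last first.
    by rewrite y0 mul0r.
  rewrite addr0 => E; rewrite -[RHS]E /S big_mkcond; apply: eq_bigr => j _.
  rewrite col_mxEu mxE /= (_ : (r + k < r)%N = false) ?addKn ?ltnS; last by lia.
  by case: (_ <= _)%N; rewrite ?mulr1 ?mulr0.
apply/rowP=> i; rewrite mxE -(splitK i); case: (split i) => j /=; last exact: y0.
have : S j.+1 = 0 by apply: S0.
rewrite /S (bigD1 j) //= => <-; rewrite -[LHS]addr0; congr (_ + _).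
apply: etrans (esym (S0 j (ltnW (ltn_ord j)))) _; apply: eq_bigl => i'.
by rewrite ltnS ltn_neqAle andbC.
Qed.

Lemma sg_vb k : sg (vb k) = 1.
Proof.
rewrite /vb; case: ifP => kr; first exact: sg_Delta.
have k2 : ((k - r).+1 < r)%N by have := ltn_ord k; lia.
rewrite sg_sum big_split_ord /= [X in _ + X]big1 => [|j _]; last by rewrite row_mxEr mxE.
rewrite addr0.
under eq_bigr => j _.
  rewrite row_mxEl (_ : _ 0 j = unitv r (k - r) 0 j * 1 - unitv r (k - r).+1 0 j * 1); last first.
    by rewrite !mxE !mulr1.
  over.
rewrite sumrB (sum_delta (fun=> 1)) ?(ltnW k2) //.
have -> : \sum_(i < r) unitv r (k - r).+1 0 i * 1 = 1 by rewrite (sum_delta (fun=> 1)).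
by [].
Qed.

Lemma sg_sumv (I : finType) (F : I -> F2v (r + r)) :
  sg (\sum_i F i) = \prod_i sg (F i).
Proof. exact: (big_morph _ (@sgD C r) (sg0 C r)). Qed.

Lemma sgZ (x : 'F_2) v : sg (x *: v) = if x == 1 then sg v else 1.
Proof.
by rewrite (F2_bit x); case: (x != 0); rewrite ?scale1r ?scale0r ?sg0.
Qed.

Lemma coord_sum v : sg v = 1 -> v = \sum_k (v *m coord_mx) 0 k *: vb k.
Proof.
move=> ev; apply/eqP; rewrite -subr_eq0; apply/eqP/even_coord0.
  rewrite oppF2v sgD ev mul1r sg_sumv big1 // => k _.
  by rewrite sgZ sg_vb if_same.
rewrite mulmxBl -[X in _ - X *m _](_ : v *m coord_mx *m vb_mx = _).
  by rewrite -(mulmxA (v *m coord_mx)) vb_coord mulmx1 subrr.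
by rewrite mulmx_sum_row; apply: eq_bigr => k _; rewrite rowK.
Qed.

(** [coords] is a choice among solutions; [vb_coord] makes the solution unique, hence linear in [v]
    on even vectors. *)
Lemma coordsE v : sg v = 1 -> coords v = v *m coord_mx.
Proof.
move=> ev.
have ex := coord_sum ev.
rewrite /coords; case: pickP => [a /eqP E /= | /(_ (v *m coord_mx))]; last by rewrite -ex eqxx.
have -> : v = a *m vb_mx.
  by rewrite E mulmx_sum_row; apply: eq_bigr => k _; rewrite rowK.
by rewrite -mulmxA vb_coord mulmx1.
Qed.

Lemma coords_sum v : sg v = 1 -> v = \sum_k coords v 0 k *: vb k.
Proof. by move=> ev; rewrite coordsE // -coord_sum. Qed.

Lemma sgnZ_sqr z : sgnZ C z * sgnZ C z = 1.
Proof. by rewrite /sgnZ; case: ifP; rewrite ?mulN1r ?opprK ?mulr1. Qed.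

Lemma eps_b_sqr (i j : 'I_m) : eps_b C i j * eps_b C i j = 1.
Proof. by rewrite /eps_b; do 2?[case: ifP => _]; rewrite ?mulr1 ?sgnZ_sqr. Qed.

Lemma coordsD u v : sg u = 1 -> sg v = 1 -> coords (u + v) = coords u + coords v.
Proof. by move=> eu ev; rewrite !coordsE ?mulmxDl // sgD eu ev mulr1. Qed.

(** [coords] is additive on even vectors, and reducing coordinates mod 2 is harmless because the
    basis values square to 1. *)
Lemma epsDl u v b : sg u = 1 -> sg v = 1 -> eps (u + v) b = eps u b * eps v b.
Proof.
move=> eu ev; rewrite /eps -big_split; apply: eq_bigr => i _.
rewrite -big_split; apply: eq_bigr => j _ /=; rewrite coordsD // mxE mulrDl.
move: (_ * _) (_ * _) => x y; rewrite (F2_bit x) (F2_bit y).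
by case: (x != 0); case: (y != 0); rewrite /= ?mulr1 ?mul1r ?eps_b_sqr.
Qed.

Lemma epsDr u v b : sg u = 1 -> sg v = 1 -> eps b (u + v) = eps b u * eps b v.
Proof.
move=> eu ev; rewrite /eps -big_split; apply: eq_bigr => i _.
rewrite -big_split; apply: eq_bigr => j _ /=; rewrite coordsD // mxE mulrDr.
move: (_ * _) (_ * _) => x y; rewrite (F2_bit x) (F2_bit y).
by case: (x != 0); case: (y != 0); rewrite /= ?mulr1 ?mul1r ?eps_b_sqr.
Qed.

Lemma eps_sqr a b : eps a b * eps a b = 1.
Proof.
rewrite /eps -big_split big1 // => i _ /=; rewrite -big_split big1 // => j _ /=.
by case: ifP; rewrite ?mulr1 ?eps_b_sqr.
Qed.

Lemma eps_neq0 a b : eps a b != 0.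
Proof.
apply/eqP=> E; have := eps_sqr a b.
by rewrite E mul0r => /eqP; rewrite eq_sym oner_eq0.
Qed.

(** Off the diagonal one factor is 1 and the other is the sign; on the diagonal a square meets the
    even weight of [vb i]. *)
Lemma eps_b_sym (i j : 'I_m) : eps_b C i j * eps_b C j i = sg (hprod (vb i) (vb j)).
Proof.
have hC : hprod (vb j) (vb i) = hprod (vb i) (vb j) by apply: bitP => k; bits.
have hh : hprod (vb j) (vb j) = vb j by apply: bitP => k; bits.
have [->|ij] := eqVneq i j; first by rewrite hh eps_b_sqr sg_vb.
rewrite /eps_b (negbTE ij) [j == i]eq_sym (negbTE ij) hC sgnZ_wt.
case: ltngtP => [_|_|/val_inj E]; rewrite ?mulr1 ?mul1r //.
by rewrite E eqxx in ij.
Qed.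

Lemma hprodDl (n : nat) (u v w : F2v n) : hprod (u + v) w = hprod u w + hprod v w.
Proof. by apply: bitP => k; bits. Qed.

Lemma hprodDr (n : nat) (u v w : F2v n) : hprod w (u + v) = hprod w u + hprod w v.
Proof. by apply: bitP => k; bits. Qed.

Lemma sg_hprod_sum a b : sg a = 1 -> sg b = 1 ->
  sg (hprod a b) = \prod_i \prod_j
     (if coords a 0 i * coords b 0 j == 1 then sg (hprod (vb i) (vb j)) else 1).
Proof.
move=> ea eb; rewrite {1}(coords_sum ea) {1}(coords_sum eb).
have h0l w : hprod 0 w = 0 :> F2v (r + r) by apply: bitP => k; bits.
have h0r w : hprod w 0 = 0 :> F2v (r + r) by apply: bitP => k; bits.
rewrite (big_morph (fun u => hprod u _) (fun u v => hprodDl u v _) (h0l _)) sg_sumv.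
apply: eq_bigr => i _.
rewrite (big_morph (hprod _) (fun u v => hprodDr u v _) (h0r _)) sg_sumv.
apply: eq_bigr => j _; rewrite -sgZ; congr sg; apply/rowP=> k.
by rewrite !mxE mulrACA.
Qed.

Lemma eps_sym a b : sg a = 1 -> sg b = 1 -> eps a b * eps b a = sg (hprod a b).
Proof.
move=> ea eb; rewrite sg_hprod_sum // {2}/eps exchange_big -big_split.
apply: eq_bigr => i _ /=; rewrite -big_split; apply: eq_bigr => j _ /=.
by rewrite [coords b 0 j * _]mulrC -eps_b_sym; case: ifP; rewrite ?mulr1.
Qed.

Lemma DeltaD (u v : F2v r) : Delta (u + v) = Delta u + Delta v.
Proof. by rewrite /Delta add_row_mx. Qed.

Lemma DeltaM (u v : F2v r) : hprod (Delta u) (Delta v) = Delta (hprod u v).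
Proof.
apply/rowP=> i; rewrite !mxE.
by case: (split i) => j; rewrite mxE.
Qed.

Lemma coords_Delta (g : F2v r) (i : 'I_m) : ~~ (i < r)%N -> coords (Delta g) 0 i = 0.
Proof.
move=> ir; rewrite coordsE ?sg_Delta // mul_row_col -mulmxDr mxE big1 // => j _.
rewrite !mxE (negbTE ir).
by case: (_ <= _)%N; rewrite ?mulr0 // (_ : _ + _ = 0) ?mulr0 //; apply/val_inj.
Qed.

(** Only basis vectors with index below [r] occur in [Delta g]. Since these come first, an earlier
    second index is diagonal too, and a product of diagonal vectors has weight 0; a later one gives
    1 by definition. *)
Lemma eps_Deltal (g : F2v r) b : eps (Delta g) b = 1.
Proof.
rewrite /eps big1 // => i _; rewrite big1 // => j _.
case: (ltnP i r) => ir; last by rewrite coords_Delta -?leqNgt // mul0r.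
case: ifP => // _; rewrite /eps_b; case: eqP => [_|_].
  by rewrite sgnZ_half /vb ir ?ipow_Delta // (sg_even C) sg_Delta.
case: ltnP => // ji.
by rewrite sgnZ_wt /vb ir (leq_ltn_trans ji ir) DeltaM sg_Delta.
Qed.

Lemma eps_Deltar (g : F2v r) a : sg a = 1 -> eps a (Delta g) = sg (hprod a (Delta g)).
Proof. by move=> ea; rewrite -eps_sym ?sg_Delta // eps_Deltal mulr1. Qed.

End Eps.

(** * The quotient and its grading *)

Section SpanInduction.
Variables (K : fieldType) (vT : vectType K).

Lemma span_ind (X : seq vT) (Q : vT -> Prop) :
  Q 0 -> (forall k x v, x \in X -> Q v -> Q (k *: x + v)) ->
  forall v, v \in <<X>>%VS -> Q v.
Proof.
move=> Q0 QS; elim: X QS => [|x X IH] QS v.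
  by rewrite span_nil memv0 => /eqP->.
rewrite span_cons => /memv_addP[_ /vlineP[k ->] [w wX ->]].
apply: (QS); first exact: mem_head.
by apply: IH => // k' x' v' x'X; apply: QS; rewrite inE x'X orbT.
Qed.

Lemma linear_at0 (U : lmodType K) (F : vT -> U) : linear F -> F 0 = 0.
Proof.
move=> lF; have := lF (-1) 0 0.
by rewrite scaler0 addr0 scaleN1r addNr.
Qed.

Lemma linear_scale (U : lmodType K) (F : vT -> U) k x : linear F -> F (k *: x) = k *: F x.
Proof. by move=> lF; rewrite -[k *: x]addr0 lF (linear_at0 lF) addr0. Qed.

Lemma linear_sumZ (U : lmodType K) (F : vT -> U) (I : finType) (P : pred I)
    (c : I -> K) (w : I -> vT) : linear F ->
  F (\sum_(i | P i) c i *: w i) = \sum_(i | P i) c i *: F (w i).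
Proof.
move=> lF; apply: (big_rec2 (fun x y => F x = y)); first exact: linear_at0.
by move=> i y x _ <-; rewrite lF.
Qed.

Lemma span_ext (U : lmodType K) (F F' : vT -> U) (X : seq vT) :
  linear F -> linear F' -> {in X, F =1 F'} -> {in <<X>>%VS, F =1 F'}.
Proof.
move=> lF lF' E; apply: span_ind; first by rewrite !linear_at0.
by move=> k x v xX Ev; rewrite lF lF' Ev E.
Qed.

End SpanInduction.

(** Equality on [IS] is transported from ['I_3] through [inord]; the match on the right reduces. *)
Lemma IS_eqE (a b : IS) :
  (a == b) = match a, b with
             | h0, h0 | hhalf, hhalf | h16, h16 => true
             | _, _ => false
             end.
Proof. by case: a; case: b; apply/eqP. Qed.

(** Ignoring [c] when [d] is set is the factor d_perp in the degree (d, d_perp alpha). *)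
Definition mkIS (d c : bool) : IS := if d then h16 else if c then hhalf else h0.

Definition deg (r : nat) (p : SGidx r) : lam r r :=
  [ffun i => mkIS (bit p.1 i) (bit p.2 i)].

(** * Degrees, the codes D_G and C_G, and the subgroups Delta^d *)

Section Codes.
Variables (C : numClosedFieldType) (r : nat) (G : {set F2v r}).
Hypothesis r_gt0 : (0 < r)%N.
Hypothesis Gsub : zmod_closed G.
Hypothesis G1 : const_mx 1 \in G.
Implicit Types (a b c d ga : F2v (r + r)) (p q : SGidx r).
Local Notation sg := (@sg C r).
Local Notation eps := (@eps C r).

Definition idx : {set SGidx r} := [set p | (p.1 \in D_G G) && (p.2 \in C_G G)].

Lemma mem_idx d a : ((d, a) \in idx) = (d \in D_G G) && (a \in C_G G).
Proof. by rewrite inE. Qed.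

Lemma degE p la :
  (p.1 == dvec la) && (hprod (dperp p.1) p.2 == cvec la) = (deg p == la).
Proof.
have bd (mu : lam r r) i : bit (dvec mu) i = (mu i == h16).
  by rewrite /bit mxE /ISd; case: (mu i == h16); rewrite ?oner_eq0 ?eqxx.
have bc (mu : lam r r) i : bit (cvec mu) i = (mu i == hhalf).
  by rewrite /bit mxE /ISc; case: (mu i == hhalf); rewrite ?oner_eq0 ?eqxx.
apply/andP/eqP => [[/eqP E1 /eqP E2] | <-].
  apply/ffunP=> i; rewrite ffunE E1 bd.
  have := congr1 (fun v => bit v i) E2; rewrite E1 bitM bit_dperp bd bc.
  by case: (la i); rewrite /mkIS !IS_eqE /= => // ->.
split; apply/eqP/bitP => i; rewrite ?bitM ?bit_dperp.
  by rewrite bd ffunE; case: (bit p.1 i); case: (bit p.2 i); rewrite IS_eqE.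
by rewrite bc ffunE; case: (bit p.1 i); case: (bit p.2 i); rewrite IS_eqE.
Qed.

Lemma D_GP d : reflect (exists2 g, g \in G & d = Delta g) (d \in D_G G).
Proof. exact: imsetP. Qed.

Lemma G_add g g' : g \in G -> g' \in G -> g + g' \in G.
Proof. by move=> gG g'G; rewrite -(oppF2v g'); case: Gsub => _; apply. Qed.

Lemma D_G0 : 0 \in D_G G.
Proof.
by apply/D_GP; exists 0; [case: Gsub | rewrite /Delta row_mx0].
Qed.

Lemma D_G1 : const_mx 1 \in D_G G.
Proof. by apply/D_GP; exists (const_mx 1) => //; rewrite /Delta row_mx_const. Qed.

Lemma D_GD d d' : d \in D_G G -> d' \in D_G G -> d + d' \in D_G G.
Proof.
move=> /D_GP[g gG ->] /D_GP[g' g'G ->]; apply/D_GP.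
by exists (g + g'); [apply: G_add | rewrite DeltaD].
Qed.

Lemma C_GP a : reflect (forall d, d \in D_G G -> sg (hprod a d) = 1) (a \in C_G G).
Proof.
rewrite inE; apply: (iffP forall_inP) => H d dD.
  by apply/eqP; rewrite -sg_even H.
by rewrite (sg_even C) H.
Qed.

Lemma C_GD a b : a \in C_G G -> b \in C_G G -> a + b \in C_G G.
Proof.
move=> /C_GP aG /C_GP bG; apply/C_GP => d dD.
by rewrite hprodDl sgD aG // bG // mulr1.
Qed.

Lemma C_G_Delta g : Delta g \in C_G G.
Proof. by apply/C_GP => _ /D_GP[h _ ->]; rewrite DeltaM sg_Delta. Qed.

Lemma C_G0 : 0 \in C_G G.
Proof. by rewrite -(row_mx0 _ 1 r r) -/(Delta 0) C_G_Delta. Qed.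

Lemma hprodC a b : hprod a b = hprod b a.
Proof. by apply: bitP => i; bits. Qed.

Lemma hprod1 a : hprod a (const_mx 1) = a.
Proof. by apply: bitP => i; rewrite bitM bit1 andbT. Qed.

Lemma C_G_even a : a \in C_G G -> sg a = 1.
Proof. by move=> /C_GP/(_ _ D_G1); rewrite hprod1. Qed.

Lemma DeltadP d ga :
  reflect ((exists g, ga = Delta g) /\ (forall i, bit ga i -> bit d i)) (ga \in Deltad d).
Proof.
rewrite inE; apply: (iffP andP) => [[/eqP E /imsetP[g _ Eg]] | [[g ->] H]].
  split; first by exists g.
  by move=> i; rewrite -E bitM => /andP[].
split; last by apply/imsetP; exists g.
apply/eqP/bitP => i; rewrite bitM; have := H i.
by case: (bit (Delta g) i) => [->|] //; rewrite andbF.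
Qed.

Lemma Deltad_C d ga : ga \in Deltad d -> ga \in C_G G.
Proof. by case/DeltadP=> [[g ->] _]; apply: C_G_Delta. Qed.

Lemma Deltad0 d : 0 \in Deltad d.
Proof.
apply/DeltadP; split; first by exists 0; rewrite /Delta row_mx0.
by move=> i; rewrite bit0.
Qed.

Lemma Deltad_add d ga ga' : ga \in Deltad d -> ga' \in Deltad d -> ga + ga' \in Deltad d.
Proof.
case/DeltadP=> [[g ->] H] /DeltadP[[g' ->] H']; apply/DeltadP; split.
  by exists (g + g'); rewrite DeltaD.
by move=> i; rewrite bitD; have := H i; have := H' i; do 2!case: (bit (Delta _) i); auto.
Qed.

Lemma eps_gal d ga b : ga \in Deltad d -> eps ga b = 1.
Proof. by case/DeltadP=> [[g ->] _]; apply: eps_Deltal. Qed.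

Lemma eps_gar d ga a : a \in C_G G -> ga \in Deltad d -> eps a ga = sg (hprod a ga).
Proof.
by move=> aG /DeltadP[[g ->] _]; apply: eps_Deltar => //; apply: C_G_even.
Qed.

Lemma sg_ga2 d d' ga ga' : ga \in Deltad d -> ga' \in Deltad d' -> sg (hprod ga ga') = 1.
Proof. by case/DeltadP=> [[g ->] _] /DeltadP[[g' ->] _]; rewrite DeltaM sg_Delta. Qed.

Lemma deg_Deltad d a ga : ga \in Deltad d -> deg (d, a + ga) = deg (d, a).
Proof.
case/DeltadP=> [_ H]; apply/ffunP=> i; rewrite !ffunE /= bitD.
by have := H i; case: (bit d i) => //=; case: (bit ga i) => [/(_ isT)|] //; rewrite addbF.
Qed.

(** * The quotient space and coefficient functionals on it *)

Local Notation V := (Vfree C r).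
Local Notation T := (SGspace C G).
Local Notation W := (Wsp C G).
Local Notation K := (Ksp C G).
Local Notation pi := (@SGpi C r G).
Local Notation ev := (@ev C r).

Definition Krel : seq V :=
  [seq ev (p.1.1, p.1.2) - eps p.1.2 p.2 *: ev (p.1.1, p.1.2 + p.2)
      | p : SGidx r * F2v (r + r) <- enum [set p : SGidx r * F2v (r + r) |
                  [&& p.1.1 \in D_G G, p.1.2 \in C_G G & p.2 \in Deltad p.1.1]]].

Lemma KrelP (x : V) :
  reflect (exists d a ga, [/\ (d, a) \in idx, ga \in Deltad d &
             x = ev (d, a) - eps a ga *: ev (d, a + ga)]) (x \in Krel).
Proof.
apply: (iffP mapP) => [[[[d a] ga]] | [d [a [ga [pI gaD ->]]]]].
  rewrite mem_enum inE => /and3P[dD aC gaD] ->.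
  by exists d, a, ga; split; rewrite ?mem_idx ?dD.
exists ((d, a), ga) => //; rewrite mem_enum inE /=.
by rewrite mem_idx in pI; rewrite andbA pI.
Qed.

Lemma WspE : W = <<[seq ev p | p <- enum idx]>>%VS. Proof. by []. Qed.

Lemma ev_W p : p \in idx -> ev p \in W.
Proof. by move=> pI; rewrite WspE memv_span // map_f // mem_enum. Qed.

Lemma idx_shift d a ga : (d, a) \in idx -> ga \in Deltad d -> (d, a + ga) \in idx.
Proof.
by rewrite !mem_idx => /andP[-> aC] /Deltad_C /(C_GD aC) ->.
Qed.

Lemma K_sub_W : (K <= W)%VS.
Proof.
apply/span_subvP=> x /KrelP[d [a [ga [pI gaD ->]]]].
by rewrite memvB ?memvZ ?ev_W // idx_shift.
Qed.

Lemma pi_linear : linear pi.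
Proof. by move=> k x y; rewrite /SGpi !linearP. Qed.

Lemma pi_val (x : T) : pi (vsval x) = x.
Proof.
apply: val_inj; rewrite /SGpi /= vsprojK ?memv_pi //.
by rewrite daddv_pi_id ?capv_diff //; apply: subvsP.
Qed.

Lemma val_W (x : T) : vsval x \in W.
Proof. by apply: subvP (diffvSl W K) _ (subvsP x). Qed.

Lemma pi_sub v : v \in W -> v - vsval (pi v) \in K.
Proof.
move=> vW; rewrite /SGpi vsprojK ?memv_pi //.
have vWK : v \in (W + K)%VS by apply: subvP (addvSl _ _) _ vW.
by rewrite -{1}(addv_pi1_pi2 vWK) addrAC subrr add0r memv_pi2.
Qed.

(** The universal property of the quotient: [vsval (pi v)] is the representative of the class of [v]
    in the chosen complement and differs from [v] by an element of [K], so a map that respects the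
    relations does not see the choice. *)
Lemma desc (U : lmodType C) (F : V -> U) : linear F ->
  (forall d a ga, (d, a) \in idx -> ga \in Deltad d ->
     F (ev (d, a)) = eps a ga *: F (ev (d, a + ga))) ->
  forall v, v \in W -> F (vsval (pi v)) = F v.
Proof.
move=> lF FK v vW.
have F0 : F (v - vsval (pi v)) = 0.
  apply: (span_ext lF (F' := fun=> 0) _ _ (pi_sub vW)).
    by move=> k x y; rewrite scaler0 addr0.
  move=> x /KrelP[d [a [ga [pI gaD ->]]]].
  by rewrite addrC -scaleNr lF scaleNr -FK // addNr.
have := lF (-1) (vsval (pi v)) v; rewrite !scaleN1r [in LHS]addrC F0 addrC.
by move/esym/subr0_eq.
Qed.

Definition bas p : T := pi (ev p).

Definition basis_seq (A : {set SGidx r}) : seq T := [seq bas p | p <- enum A].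

Lemma basis_seqP (A : {set SGidx r}) x :
  reflect (exists2 p, p \in A & x = bas p) (x \in basis_seq A).
Proof.
apply: (iffP mapP) => [[p] | [p pA ->]]; first by rewrite mem_enum; exists p.
by exists p; rewrite ?mem_enum.
Qed.

Lemma basis_full (x : T) : x \in <<basis_seq idx>>%VS.
Proof.
rewrite -(pi_val x).
apply: (@span_ind _ _ [seq ev p | p <- enum idx] (fun v => pi v \in _)).
- by rewrite (linear_at0 pi_linear) mem0v.
- move=> k _ v /mapP[p pI ->] Hv; rewrite pi_linear rpredD ?rpredZ //.
  by apply/memv_span/basis_seqP; exists p; rewrite // -mem_enum.
- exact: val_W.
Qed.

Lemma bas_ext (U : lmodType C) (F F' : T -> U) :
  linear F -> linear F' -> (forall p, p \in idx -> F (bas p) = F' (bas p)) -> F =1 F'.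
Proof.
move=> lF lF' E x; apply: (span_ext lF lF' _ (basis_full x)).
by move=> _ /basis_seqP[p pI ->]; apply: E.
Qed.

Lemma pi_K v : v \in K -> pi v = 0.
Proof.
move=> vK; have vW := subvP K_sub_W _ vK.
have := memvB vK (pi_sub vW); rewrite opprB addrCA subrr addr0 => H.
apply: val_inj => /=; apply/eqP; rewrite -memv0 -(capv_diff W K).
by rewrite memv_cap subvsP.
Qed.

Lemma bas_shift d a ga : (d, a) \in idx -> ga \in Deltad d ->
  bas (d, a + ga) = sg (hprod a ga) *: bas (d, a).
Proof.
move=> pI gaD; have := pI; rewrite mem_idx => /andP[_ aC].
have : pi (ev (d, a) - eps a ga *: ev (d, a + ga)) = 0.
  by apply/pi_K/memv_span/KrelP; exists d, a, ga.
rewrite addrC -scaleNr pi_linear scaleNr addrC => /subr0_eq E.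
rewrite /bas E.
by rewrite scalerA -(eps_gar aC gaD) eps_sqr scale1r.
Qed.

(* Descends to the quotient, where it reads off the coefficient of e_a . t_d. *)
Definition phi p (v : V) : C^o :=
  \sum_(ga in Deltad p.1) eps p.2 ga * v (p.1, p.2 + ga).

Lemma phi_linear p : linear (phi p).
Proof.
move=> k x y; rewrite /phi scaler_sumr -big_split; apply: eq_bigr => ga _ /=.
by rewrite !ffunE mulrDr mulrCA.
Qed.

Lemma phi_ev d a d' b : phi (d, a) (ev (d', b)) =
  if (d' == d) && (a + b \in Deltad d) then eps a (a + b) else 0.
Proof.
rewrite /phi /=; have aab : a + (a + b) = b by rewrite addrA addF2vv add0r.
have E ga : (ev (d', b) (d, a + ga)) = if (d' == d) && (ga == a + b) then 1 else 0.
  rewrite ffunE xpair_eqE [d == d']eq_sym; congr (if _ && _ then _ else _).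
  by apply/eqP/eqP => [<- | ->]; rewrite ?aab // addrA addF2vv add0r.
under eq_bigr => ga _ do rewrite E.
case: eqP => [_|_] /=; last by rewrite big1 // => ga _; rewrite mulr0.
case: ifP => H; last first.
  rewrite big1 // => ga gaD; case: eqP => [E'|]; rewrite ?mulr0 //.
  by rewrite -E' gaD in H.
rewrite (bigD1 (a + b)) //= eqxx mulr1 big1 ?addr0 // => ga /andP[_ /negbTE ->].
by rewrite mulr0.
Qed.

Lemma phi_bas p q : p \in idx -> q \in idx -> phi p (vsval (bas q)) = phi p (ev q).
Proof.
case: p => d a pI qI; apply: desc; last exact: ev_W; first exact: phi_linear.
move=> d' b ga qI' gaD; rewrite !phi_ev.
case: eqP => [Ed | _] /=; last by rewrite scaler0.
move: pI; rewrite mem_idx => /andP[_ aC].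
rewrite mem_idx in qI'; case/andP: qI' => _ bC.
rewrite Ed in gaD.
have -> : (a + (b + ga) \in Deltad d) = (a + b \in Deltad d).
  apply/idP/idP => H; last by rewrite addrA Deltad_add.
  by rewrite -(addF2vK (a + b) ga) Deltad_add // -addrA.
case: ifP => H; last by rewrite scaler0.

have gaG := Deltad_C gaD; have HG := Deltad_C H.
rewrite addrA (eps_gar bC gaD) (eps_gar aC H) (eps_gar aC (Deltad_add H gaD)).
(* The two sides differ by the sign of the product of [a + b] and [ga], which is 1 because both are
   diagonal. *)
rewrite /GRing.scale /= -sgD -[LHS]mulr1 -(sg_ga2 H gaD) -sgD; congr sg.
by apply: bitP => i; bits.
Qed.

Lemma phi_basE d a d' b : (d, a) \in idx -> (d', b) \in idx ->
  phi (d, a) (vsval (bas (d', b))) =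
  if (d' == d) && (a + b \in Deltad d) then sg (hprod a (a + b)) else 0.
Proof.
move=> pI qI; rewrite phi_bas // phi_ev; case: ifP => // /andP[_ H].
by rewrite (eps_gar _ H) //; move: pI; rewrite mem_idx => /andP[].
Qed.

Lemma bas_neq0 p : p \in idx -> bas p != 0.
Proof.
case: p => d a pI; apply/eqP=> E; have := phi_basE pI pI.
rewrite E eqxx addF2vv Deltad0 /= (linear_at0 (phi_linear _)) => /esym/eqP.
have -> : hprod a 0 = 0 by apply: bitP => i; rewrite bitM bit0 andbF.
by rewrite sg0 oner_eq0.
Qed.

Lemma phi_val_linear p : linear (fun x : T => phi p (vsval x)).
Proof. by move=> k x y; rewrite linearP phi_linear. Qed.

(** The vectors [bas p] only span: those over one coset of Delta^d are proportional, and each of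
    them contributes the same term. The factor [#|Deltad p.1|%:R^-1] averages over the coset. *)
Lemma phi_expansion (x : T) :
  x = \sum_(p in idx) (#|Deltad p.1|%:R^-1 * phi p (vsval x)) *: bas p.
Proof.
pose F (y : T) : T := \sum_(p in idx) (#|Deltad p.1|%:R^-1 * phi p (vsval y)) *: bas p.
rewrite -/(F x); move: x; apply: (bas_ext (F := fun y => y) (F' := F)) => //.
  move=> k y z; rewrite scaler_sumr -big_split; apply: eq_bigr => p _ /=.
  by rewrite phi_val_linear mulrDr scalerDl scalerA mulrCA.
case=> d b qI; have := qI; rewrite mem_idx => /andP[dD bC].
pose A := [set (d, b + ga) | ga in Deltad d].
have NA : #|A| = #|Deltad d| by rewrite card_imset // => ga ga' [] /addrI.
have N0 : #|Deltad d|%:R != 0 :> C.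
  by rewrite pnatr_eq0 -lt0n; apply/card_gt0P; exists 0; apply: Deltad0.
transitivity (\sum_(p in A) #|Deltad d|%:R^-1 *: bas (d, b)).
  by rewrite sumr_const NA -scaler_nat scalerA divff ?scale1r.
rewrite big_mkcond [RHS]big_mkcond; apply: eq_bigr => -[d' a] _ /=.
have AE : ((d', a) \in A) = ((d', a) \in idx) && (d == d') && (a + b \in Deltad d').
  apply/imsetP/andP => [[ga gaD [-> ->]] | [/andP[aI /eqP->] abD]].
    by rewrite eqxx idx_shift // addrAC addF2vv add0r.
  by exists (a + b); rewrite // [a + b]addrC addrA addF2vv add0r.
rewrite AE; case: ifP => [/andP[/andP[aI /eqP Ed] abD]|].
  subst d'; rewrite aI phi_basE // eqxx abD /=.
  have -> : a = b + (a + b) by rewrite [a + b]addrC addrA addF2vv add0r.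
  rewrite [b + (a + b) + b]addrAC addF2vv add0r bas_shift // scalerA -mulrA -sgD.
  rewrite (_ : sg _ = 1) ?mulr1 // -(sg_ga2 abD abD); congr sg.
  by apply: bitP => i; bits.
case: ifP => // aI; rewrite phi_basE // => ->.
by rewrite mulr0 scale0r.
Qed.

Lemma phi_sep (x : T) : x != 0 -> exists2 p, p \in idx & phi p (vsval x) != 0.
Proof.
move=> x0; apply/exists_inP; apply: contraNT x0.
rewrite negb_exists_in => /forall_inP H; rewrite [x]phi_expansion big1 // => p pI.
by have := H p pI; rewrite negbK => /eqP->; rewrite mulr0 scale0r.
Qed.

(** * Homogeneous components and the grading *)

Definition restr (la : lam r r) (v : V) : V :=
  [ffun p => if deg p == la then v p else 0].

(** A projection given by a formula, from which directness of the grading is deduced; [gproj] is a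
    projection onto the summand only once directness is known. *)
Definition compo la (x : T) : T := pi (restr la (vsval x)).

Lemma restr_linear la : linear (fun v => pi (restr la v)).
Proof.
move=> k x y; rewrite -pi_linear; congr SGpi; apply/ffunP=> p; rewrite !ffunE.
by case: ifP; rewrite // scaler0 addr0.
Qed.

Lemma compo_linear la : linear (compo la).
Proof. by move=> k x y; rewrite /compo linearP restr_linear. Qed.

Lemma compo_bas la p : p \in idx -> compo la (bas p) = if deg p == la then bas p else 0.
Proof.
have E q : pi (restr la (ev q)) = if deg q == la then bas q else 0.
  case: ifP => H.
    congr SGpi; apply/ffunP=> q'; rewrite !ffunE; case: (q' =P q) => [->|_]; rewrite ?H //.
    by rewrite if_same.
  rewrite -(linear_at0 pi_linear); congr SGpi; apply/ffunP=> q'; rewrite !ffunE.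
  by case: (q' =P q) => [->|_]; rewrite ?H ?if_same.
move=> pI; rewrite -E; apply: (desc (restr_linear la)); last exact: ev_W.
move=> d a ga aI gaD; rewrite !E deg_Deltad //; case: ifP => _; last by rewrite scaler0.
have := aI; rewrite mem_idx => /andP[_ aC].
by rewrite bas_shift // scalerA (eps_gar aC gaD) sg_sqr scale1r.
Qed.

Lemma gcompE la :
  gcomp (S_G C G) la = <<basis_seq [set p in idx | deg p == la]>>%VS.
Proof.
rewrite (_ : [set p in idx | deg p == la] = [set p : SGidx r | [&& p.1 \in D_G G,
  p.2 \in C_G G, p.1 == dvec la & hprod (dperp p.1) p.2 == cvec la]]) //.
by apply/setP=> p; rewrite !inE -degE -!andbA.
Qed.

Lemma bas_gcomp p : p \in idx -> bas p \in gcomp (S_G C G) (deg p).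
Proof.
by move=> pI; rewrite gcompE; apply/memv_span/basis_seqP; exists p; rewrite // inE pI eqxx.
Qed.

Lemma gcomp_ext (U : lmodType C) (F F' : T -> U) la :
  linear F -> linear F' ->
  (forall p, p \in idx -> deg p = la -> F (bas p) = F' (bas p)) ->
  {in gcomp (S_G C G) la, F =1 F'}.
Proof.
move=> lF lF' E; rewrite gcompE; apply: span_ext => //.
by move=> _ /basis_seqP[p /setIdP[pI /eqP Ep] ->]; apply: E.
Qed.

Lemma compo_gcomp la mu x : x \in gcomp (S_G C G) la ->
  compo mu x = if la == mu then x else 0.
Proof.
move: x; apply: gcomp_ext; first exact: compo_linear.
  by move=> k x y; case: ifP; rewrite ?scaler0 ?addr0.
by move=> p pI <-; rewrite compo_bas.
Qed.

Lemma grading_direct : directv (\sum_(la : lam r r) gcomp (S_G C G) la)%VS.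
Proof.
apply/directv_sum_independent => us usV E la _.
have := linear_sumZ predT (fun=> 1) us (compo_linear la).
under eq_bigr => mu _ do rewrite scale1r.
under [in X in _ = X]eq_bigr => mu _ do rewrite scale1r.
rewrite E (linear_at0 (compo_linear la)) (bigD1 la) //= big1 => [|mu /negbTE mula].
  by rewrite (compo_gcomp _ (usV la isT)) eqxx addr0.
by rewrite (compo_gcomp _ (usV mu isT)) mula.
Qed.

Lemma grading_full : (\sum_(la : lam r r) gcomp (S_G C G) la)%VS = fullv.
Proof.
apply/eqP; rewrite eqEsubv subvf; apply/subvP=> x _.
apply: subvP (basis_full x); apply/span_subvP => _ /basis_seqP[p pI ->].
by apply: (subvP (sumv_sup (deg p) isT (subvv _))) (bas_gcomp pI).
Qed.

Lemma gproj_linear la : linear (gproj (S_G C G) la).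
Proof. by move=> k x y; rewrite /gproj linearP. Qed.

Lemma gproj_bas la p : p \in idx ->
  gproj (S_G C G) la (bas p) = if deg p == la then bas p else 0.
Proof.
move=> pI; have dir := directv_sumP grading_direct la isT.
rewrite /gproj; case: eqP => [E | /eqP E].
  by rewrite daddv_pi_id // -E bas_gcomp.
set V' := (\sum_(mu | _) _)%VS; set U := gcomp _ _.
have pV' : bas p \in V'.
  by apply: (subvP (sumv_sup (deg p) E (subvv _))) (bas_gcomp pI).
have := @daddv_pi_add _ _ U V' (bas p) dir (subvP (addvSr _ _) _ pV').
rewrite (daddv_pi_id (U := V')) //; last by rewrite capvC.
by move/(canRL (addrK _)); rewrite subrr.
Qed.

End Codes.

(** * The product *)

Section Product.
Variables (C : numClosedFieldType) (r : nat) (G : {set F2v r}).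
Hypothesis r_gt0 : (0 < r)%N.
Hypothesis Gsub : zmod_closed G.
Hypothesis G1 : const_mx 1 \in G.
Implicit Types (a b c d ga : F2v (r + r)) (p q : SGidx r).
Local Notation sg := (@sg C r).
Local Notation ipow := (@ipow C r).
Local Notation eps := (@eps C r).
Local Notation V := (Vfree C r).
Local Notation T := (SGspace C G).
Local Notation W := (Wsp C G).
Local Notation pi := (@SGpi C r G).
Local Notation ev := (@ev C r).
Local Notation bas := (@bas C r G).
Local Notation idx := (idx G).

Definition balanced (v : F2v (r + r)) := forall k, bit v (lshift r k) = bit v (rshift r k).

Lemma balancedP v : balanced v <-> exists g, v = Delta g.
Proof.
split=> [H | [g ->] k]; last by rewrite bit_row_mxl bit_row_mxr.
exists (rsubmx v); apply: bitP => i; rewrite -(splitK i).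
case: (split i) => k /=; rewrite ?bit_row_mxl ?bit_row_mxr; last by rewrite /bit mxE.
by rewrite H /bit mxE.
Qed.

Lemma balanced_D_G d : d \in D_G G -> balanced d.
Proof. by case/D_GP => g _ ->; apply/balancedP; exists g. Qed.

Lemma balanced_Deltad d ga : ga \in Deltad d -> balanced ga.
Proof. by case/DeltadP => [[g ->] _]; apply/balancedP; exists g. Qed.

Lemma Deltad_sub d ga i : ga \in Deltad d -> bit ga i ==> bit d i.
Proof. by case/DeltadP => _ H; apply/implyP/H. Qed.

Lemma mem_Deltad d ga : balanced ga -> (forall i, bit ga i ==> bit d i) -> ga \in Deltad d.
Proof. by move=> /balancedP H H'; apply/DeltadP; split=> // i; apply/implyP/H'. Qed.

(** The hypothesis says that [u + v] is diagonal, hence of sign 1. Sign identities thereby reduce to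
    a check on the bits of one pair of coordinates. *)
Lemma sg_congr u v :
  (forall k, bit u (lshift r k) (+) bit u (rshift r k) =
             bit v (lshift r k) (+) bit v (rshift r k)) -> sg u = sg v.
Proof.
move=> H; have [g E] : exists g, u + v = Delta g.
  apply/balancedP=> k; move: (H k); rewrite !bitD; do 4?[case: (bit _ _)] => //.
by rewrite -[LHS]mulr1 -(sg_sqr C v) mulrA -sgD E sg_Delta mul1r.
Qed.

Lemma ipow_balanced v : balanced v -> ipow v = 1.
Proof. by move=> /balancedP[g ->]; apply: ipow_Delta. Qed.

(** The part of the structure constant that is independent of the summation index [ga]:
    [eps (a1 + ga) a2] equals [eps a1 a2], and the remaining factor [eps a1 ga] is the sign inside
    [pmul]. *)
Definition cst p q : C :=
  sg (hprod (hprod p.1 (dperp q.1)) (hprod p.2 q.2)) * sg (hprod (hprod p.1 q.1) q.2)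
  * ipow (hprod p.1 q.2) * eps p.2 q.2.

Definition pmul p q : T :=
  cst p q *: \sum_(ga in Deltad (hprod p.1 q.1))
                sg (hprod p.2 ga) *: bas (p.1 + q.1, p.2 + q.2 + ga).

Lemma mem_Cidx p : p \in idx -> p.2 \in C_G G.
Proof. by rewrite inE => /andP[]. Qed.

Lemma mem_Didx p : p \in idx -> p.1 \in D_G G.
Proof. by rewrite inE => /andP[]. Qed.

Lemma pi_sumZ (I : finType) (P : pred I) (c : I -> C) (w : I -> V) :
  pi (\sum_(i | P i) c i *: w i) = \sum_(i | P i) c i *: pi (w i).
Proof. exact: linear_sumZ (pi_linear _). Qed.

Lemma piZ k v : pi (k *: v) = k *: pi v.
Proof. by rewrite -[k *: v]addr0 pi_linear (linear_at0 (@pi_linear _ _ _)) addr0. Qed.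

Lemma pi_bprod p q : p \in idx -> q \in idx -> pi (bprod C p q) = pmul p q.
Proof.
case: p q => d1 a1 [d2 a2] pI qI.
have [a1C a2C] := (mem_Cidx pI, mem_Cidx qI).
rewrite /bprod piZ pi_sumZ /pmul /cst /= (sgnZD _ (_ + _)) (sgnZD _ (wt _ _ _)).
rewrite !sgnZ_wt sgnZ_half; last first.
  (* [sgnZ_half] applies because [a2] is orthogonal to [d1]. *)
  by rewrite (sg_even C) hprodC; apply/eqP; apply: (elimT (C_GP C _ _) a2C); apply: (mem_Didx pI).
rewrite -[in RHS]scalerA; congr (_ *: _); rewrite scaler_sumr; apply: eq_bigr => ga gaD.
rewrite scalerA addrAC; congr (_ *: _).
have gaC := Deltad_C C G gaD.
have [e1 eg] := (C_G_even C G1 a1C, C_G_even C G1 gaC).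
by rewrite epsDl // (eps_gal _ _ _ gaD) // mulr1 mulrC (eps_gar C r_gt0 G1 a1C gaD).
Qed.

Lemma cst_neq0 p q : cst p q != 0.
Proof.
have s0 v : sg v != 0 by case/orP: (sg_pm C v) => /eqP->; rewrite ?oppr_eq0 oner_eq0.
by rewrite /cst !mulf_neq0 ?s0 ?ipow_neq0 ?eps_neq0.
Qed.

Lemma Deltad_reindex d ga0 (F : F2v (r + r) -> T) : ga0 \in Deltad d ->
  \sum_(ga in Deltad d) F ga = \sum_(ga in Deltad d) F (ga + ga0).
Proof.
move=> g0; rewrite (reindex_inj (addIr ga0)) /=; apply: eq_bigl => ga.
apply/idP/idP => H; last exact: Deltad_add.
by rewrite -(addF2vK ga ga0) Deltad_add.
Qed.

Ltac balance :=
  repeat match goal with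
  | H : balanced ?v |- context [bit ?v (lshift _ ?k)] => rewrite (H k)
  end.

Ltac caseall := do ?[case: (bit _ _)] => //.

Lemma idx_add3 p q ga : p \in idx -> q \in idx -> ga \in Deltad (hprod p.1 q.1) ->
  (p.1 + q.1, p.2 + q.2 + ga) \in idx.
Proof.
move=> pI qI gaD; rewrite mem_idx D_GD ?mem_Didx //=.
by rewrite !(C_GD C) ?mem_Cidx // (Deltad_C C _ gaD).
Qed.

(** [ga] splits along [d']. The part inside [d'] lies in the summation group and is absorbed by
    reindexing; the part outside lies in Delta^(d + d') and acts on the result by a sign. *)
Lemma pmul_shiftl d a ga q : (d, a) \in idx -> q \in idx -> ga \in Deltad d ->
  pmul (d, a) q = eps a ga *: pmul (d, a + ga) q.
Proof.
case: q => d' b pI qI gaD.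
have bd := balanced_D_G (mem_Didx pI); have bd' := balanced_D_G (mem_Didx qI).
have bga := balanced_Deltad gaD; rewrite /= in bd bd'.
have aC : a \in C_G G := mem_Cidx pI; have gaC := Deltad_C C G gaD.
have ga0D : hprod d' ga \in Deltad (hprod d d').
  apply: mem_Deltad => [k|i]; rewrite !bitE; balance => //.
  by have := Deltad_sub i gaD; caseall.
have ga1D : hprod (dperp d') ga \in Deltad (d + d').
  apply: mem_Deltad => [k|i]; rewrite !bitE; balance => //.
  by have := Deltad_sub i gaD; caseall.
rewrite /pmul [in RHS](Deltad_reindex _ ga0D) !scalerA !scaler_sumr.
apply: eq_bigr => x xD; rewrite !scalerA /=.
have bx := balanced_Deltad xD.
have -> : a + ga + b + (x + hprod d' ga) = a + b + x + hprod (dperp d') ga.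
  by apply: bitP => i; rewrite !bitE; caseall.
rewrite (bas_shift C r_gt0 G1 (idx_add3 pI qI xD) ga1D) scalerA; congr (_ *: _).
have [ea eg] := (C_G_even C G1 aC, C_G_even C G1 gaC).
rewrite /cst /= epsDl // (eps_gal _ _ _ gaD) // mulr1.
rewrite (eps_gar _ _ _ aC gaD) //.
have key : sg (hprod (hprod d (dperp d')) (hprod a b)) * sg (hprod a x) =
   sg (hprod a ga) * sg (hprod (hprod d (dperp d')) (hprod (a + ga) b)) *
   sg (hprod (a + ga) (x + hprod d' ga)) * sg (hprod (a + b + x) (hprod (dperp d') ga)).
  rewrite -!sgD; apply: sg_congr => k; rewrite !bitE; balance.
  by have := Deltad_sub (rshift r k) gaD; caseall.
set s1 := sg _ in key *.
set X := ipow _; set E := eps _ _; set s2 := sg (hprod (hprod d d') b).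
transitivity (s1 * sg (hprod a x) * (s2 * X * E)); first by ring.
by rewrite key; ring.
Qed.

Lemma pmul_shiftr d b ga p : p \in idx -> (d, b) \in idx -> ga \in Deltad d ->
  pmul p (d, b) = eps b ga *: pmul p (d, b + ga).
Proof.
case: p => d' a pI qI gaD.
have bd := balanced_D_G (mem_Didx qI); have bd' := balanced_D_G (mem_Didx pI).
have bga := balanced_Deltad gaD; rewrite /= in bd bd'.
have aC : a \in C_G G := mem_Cidx pI; have gaC := Deltad_C C G gaD.
have bC : b \in C_G G := mem_Cidx qI.
have ga0D : hprod d' ga \in Deltad (hprod d' d).
  apply: mem_Deltad => [k|i]; rewrite !bitE; balance => //.
  by have := Deltad_sub i gaD; caseall.
have ga1D : hprod (dperp d') ga \in Deltad (d' + d).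
  apply: mem_Deltad => [k|i]; rewrite !bitE; balance => //.
  by have := Deltad_sub i gaD; caseall.
rewrite /pmul [in RHS](Deltad_reindex _ ga0D) !scalerA !scaler_sumr.
apply: eq_bigr => x xD; rewrite !scalerA /=.
have bx := balanced_Deltad xD.
have -> : a + (b + ga) + (x + hprod d' ga) = a + b + x + hprod (dperp d') ga.
  by apply: bitP => i; rewrite !bitE; caseall.
rewrite (bas_shift C r_gt0 G1 (idx_add3 pI qI xD) ga1D) scalerA; congr (_ *: _).
have [eb eg] := (C_G_even C G1 bC, C_G_even C G1 gaC).
rewrite /cst /= epsDr //.
rewrite (eps_gar _ _ _ aC gaD) // (eps_gar _ _ _ bC gaD) //.
(* The half weight is not additive: shifting [b] produces the sign of the overlap of [hprod d' b]
   and [hprod d' ga]. *)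
rewrite [hprod d' (b + ga)]hprodDr ipowD [ipow (hprod d' ga)]ipow_balanced ?mulr1; last first.
  by move=> k; rewrite !bitE; balance.
have key : sg (hprod (hprod d' (dperp d)) (hprod a b)) *
   sg (hprod (hprod d' d) b) * sg (hprod a x) =
   sg (hprod b ga) * sg (hprod (hprod d' (dperp d)) (hprod a (b + ga))) *
   sg (hprod (hprod d' d) (b + ga)) * sg (hprod (hprod d' b) (hprod d' ga)) *
   sg (hprod a ga) *
   sg (hprod a (x + hprod d' ga)) * sg (hprod (a + b + x) (hprod (dperp d') ga)).
  rewrite -!sgD; apply: sg_congr => k; rewrite !bitE; balance.
  by have := Deltad_sub (rshift r k) gaD; caseall.
set X := ipow _; set E := eps _ _.
rewrite [LHS](_ : _ = sg (hprod (hprod d' (dperp d)) (hprod a b)) *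
  sg (hprod (hprod d' d) b) * sg (hprod a x) * (X * E)); last by ring.
by rewrite key; ring.
Qed.

Lemma mulV_linearl g : linear (fun f : V => pi (mulV f g)).
Proof.
move=> k f f'; rewrite -pi_linear; congr SGpi; rewrite /mulV scaler_sumr -big_split.
apply: eq_bigr => p _; rewrite scaler_sumr -big_split; apply: eq_bigr => q _ /=.
by rewrite !ffunE mulrDl scalerDl scalerA /GRing.scale /= mulrA.
Qed.

Lemma mulV_linearr f : linear (fun g : V => pi (mulV f g)).
Proof.
move=> k g g'; rewrite -pi_linear; congr SGpi; rewrite /mulV scaler_sumr -big_split.
apply: eq_bigr => p _; rewrite scaler_sumr -big_split; apply: eq_bigr => q _ /=.
by rewrite !ffunE mulrDr scalerDl scalerA /GRing.scale /= mulrCA.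
Qed.

Lemma mulV_ev p q : mulV (ev p) (ev q) = bprod C p q.
Proof.
rewrite /mulV (bigD1 p) //= (bigD1 q) //= big1 => [|q' /negbTE q'q].
  rewrite !ffunE !eqxx mulr1 scale1r addr0 big1 ?addr0 // => p' /negbTE p'p.
  by rewrite big1 // => q' _; rewrite !ffunE p'p mul0r scale0r.
by rewrite !ffunE q'q mulr0 scale0r.
Qed.

Lemma gmul_linear x : linear (fun y => gmul (S_G C G) x y) /\
  linear (fun y => gmul (S_G C G) y x).
Proof.
by split=> k y z /=; [exact: mulV_linearr | exact: mulV_linearl].
Qed.

(** [gmul] multiplies chosen representatives. [desc] replaces them by symbols one argument at a
    time; for the first, the relation has to hold against every element of [W]. *)
Lemma gmul_bas p q : p \in idx -> q \in idx ->
  gmul (S_G C G) (bas p) (bas q) = pmul p q.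
Proof.
move=> pI qI /=; pose w := vsval (bas q).
have wW : w \in W := val_W _.
transitivity (pi (mulV (ev p) w)).
  apply: (desc (F := fun v => pi (mulV v w))); last exact: ev_W; first exact: mulV_linearl.
  move=> d a ga aI gaD.
  pose F v := eps a ga *: pi (mulV (ev (d, a + ga)) v).
  apply: (@span_ext _ _ _ (fun v => pi (mulV (ev (d, a)) v)) F
            [seq ev p | p <- enum idx] (mulV_linearr _) _ _ w wW).
  - move=> k v v'; rewrite /F mulV_linearr scalerDr !scalerA.
    by rewrite [_ * k]mulrC.
  - move=> _ /mapP[q' q'I ->]; rewrite mem_enum in q'I.
    by rewrite /F !mulV_ev !pi_bprod ?(idx_shift C aI gaD) // (pmul_shiftl aI q'I gaD).
rewrite -pi_bprod // -mulV_ev.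
apply: (desc (F := fun v => pi (mulV (ev p) v))); last exact: ev_W; first exact: mulV_linearr.
move=> d a ga aI gaD.
by rewrite !mulV_ev !pi_bprod ?(idx_shift C aI gaD) // (pmul_shiftr pI aI gaD).
Qed.

End Product.

(** * Unit, fusion rules, codes and simplicity *)

Section Structure.
Variables (C : numClosedFieldType) (r : nat) (G : {set F2v r}).
Hypothesis r_gt0 : (0 < r)%N.
Hypothesis Gsub : zmod_closed G.
Hypothesis G1 : const_mx 1 \in G.
Implicit Types (a b c d ga : F2v (r + r)) (p q : SGidx r).
Local Notation sg := (@sg C r).
Local Notation ipow := (@ipow C r).
Local Notation eps := (@eps C r).
Local Notation T := (SGspace C G).
Local Notation S := (S_G C G).
Local Notation bas := (@bas C r G).
Local Notation idx := (idx G).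

Lemma hprod0v a : hprod 0 a = 0.
Proof. by apply: bitP => i; rewrite bitM bit0. Qed.

Lemma hprodv0 a : hprod a 0 = 0.
Proof. by rewrite hprodC hprod0v. Qed.

Lemma sum_Deltad0 (F : F2v (r + r) -> T) : \sum_(ga in Deltad 0) F ga = F 0.
Proof.
rewrite (big_pred1 0) // => ga; apply/idP/eqP => [H | ->]; last exact: Deltad0.
by apply: bitP => i; have := Deltad_sub i H; rewrite bit0; case: (bit ga i).
Qed.

Lemma idx0 : (0, 0) \in idx.
Proof. by rewrite mem_idx (D_G0 Gsub) (C_G0 C). Qed.

Lemma gmul1l (x : T) : gmul S (gone S) x = x.
Proof.
apply: (bas_ext (F := gmul S (gone S)) (F' := id)) => //.
  by case: (gmul_linear (gone S)).
case=> d a pI; have -> : gone S = bas (0, 0) by [].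
rewrite gmul_bas ?idx0 // /pmul /cst /= !hprod0v sum_Deltad0 !sg0 ipow0.
rewrite (eps_gal _ _ _ (Deltad0 0)) // !mulr1 hprod0v sg0 !scale1r.
by rewrite add0r add0r addr0.
Qed.

Lemma gmul1r (x : T) : gmul S x (gone S) = x.
Proof.
apply: (bas_ext (F := fun x => gmul S x (gone S)) (F' := id)) => //.
  by case: (gmul_linear (gone S)).
case=> d a pI; have -> : gone S = bas (0, 0) by [].
rewrite gmul_bas ?idx0 // /pmul /cst /= !hprodv0 sum_Deltad0 !sg0 ipow0.
have aC : a \in C_G G := mem_Cidx pI.
by rewrite (eps_gar _ _ _ aC (Deltad0 0)) // !mulr1 hprodv0 sg0 !mulr1 !scale1r !addr0.
Qed.

Lemma deg_eq0 p : (deg p == lam0 r r) = (p == (0, 0)).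
Proof.
case: p => d a; apply/eqP/eqP => [/ffunP E | [-> ->]]; last first.
  by apply/ffunP=> i; rewrite !ffunE /= bit0.
congr (_, _); apply: bitP => i; have := E i; rewrite !ffunE /= bit0;
by case: (bit d i); case: (bit a i).
Qed.

Lemma gcomp_lam0 : gcomp S (lam0 r r) = <[gone S]>%VS.
Proof.
rewrite gcompE (_ : [set p in idx | _] = [set (0, 0)]).
  by rewrite /basis_seq enum_set1 span_seq1.
apply/setP=> p; apply/setIdP/set1P => [[_] | ->]; first by rewrite deg_eq0 => /eqP.
by rewrite deg_eq0 idx0.
Qed.

Lemma gcomp_neq0 la : (gcomp S la != 0%VS) = [exists p in idx, deg p == la].
Proof.
apply/idP/idP => [|/exists_inP[p pI /eqP <-]]; last first.
  apply: contra (bas_neq0 C r_gt0 G1 pI) => /eqP E.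
  by rewrite -memv0 -E bas_gcomp.
apply: contraR => H; apply/eqP; rewrite gcompE (_ : [set p in idx | _] = set0).
  by rewrite /basis_seq enum_set0 span_nil.
apply/setP=> p; rewrite in_set0; apply/negP=> /setIdP[pI Ep].
by case/negP: H; apply/exists_inP; exists p.
Qed.

Lemma sfunE (la : lam r r) :
  sfun la = \sum_k (hval (la (lshift r k)) - hval (la (rshift r k))).
Proof.
rewrite /sfun sumrB; congr (_ - _); rewrite big_mkcond big_split_ord /=.
  under eq_bigr => k _ do rewrite ltn_ord.
  by rewrite [X in _ + X]big1 ?addr0 // => k _; rewrite ltnNge leq_addr.
under [X in _ + X]eq_bigr => k _ do rewrite leq_addr.
by rewrite [X in X + _]big1 ?add0r // => k _; rewrite leqNgt ltn_ord.
Qed.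

(** As [p.1] is diagonal, the weights 1/16 cancel between left and right, and only the weights 1/2
    remain. *)
Lemma sfun_deg p : balanced p.1 ->
  sfun (deg p) = (wt r r (hprod (dperp p.1) p.2))%:~R / 2.
Proof.
move=> bp; rewrite sfunE wt_count rmorphB /= !rmorph_sum /= mulrBl !mulr_suml -sumrB.
apply: eq_bigr => k _; rewrite !ffunE !bitE bp.
by case: (bit p.1 _); case: (bit p.2 (lshift r k)); case: (bit p.2 (rshift r k)).
Qed.

(** [1^r] in [G] puts [dperp p.1] into D_G, so the weight in [sfun_deg] is even. *)
Lemma gcomp_int la : sfun la \notin Num.int -> gcomp S la = 0%VS.
Proof.
move=> H; apply/eqP; apply: contraR H; rewrite gcomp_neq0 => /exists_inP[p pI /eqP<-].
rewrite sfun_deg; last exact: balanced_D_G (mem_Didx pI).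
have ev2 : (2 %| wt r r (hprod (dperp p.1) p.2))%Z.
  rewrite (sg_even C) hprodC; apply/eqP; apply: (elimT (C_GP C _ _) (mem_Cidx pI)).
  by apply: D_GD => //; [apply: D_G1 | apply: mem_Didx].
case/dvdzP: ev2 => z ->.
by rewrite rmorphM /= mulfK // intr_int.
Qed.

Lemma gmul_closed (U : {vspace T}) la1 la2 (a b : T) :
  (forall p q, p \in idx -> q \in idx -> deg p = la1 -> deg q = la2 -> pmul C G p q \in U) ->
  a \in gcomp S la1 -> b \in gcomp S la2 -> gmul S a b \in U.
Proof.
move=> H; rewrite !gcompE => aS bS; move: a aS; apply: span_ind.
  have [_ l] := gmul_linear b.
  by rewrite (linear_at0 l) mem0v.
move=> k _ v /basis_seqP[p /setIdP[pI /eqP Ep] ->] vU.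
have [_ ->] := gmul_linear b; rewrite memvD ?memvZ //.
move: b bS {vU}; apply: span_ind.
  have [l _] := gmul_linear (bas p).
  by rewrite (linear_at0 l) mem0v.
move=> k' _ v' /basis_seqP[q /setIdP[qI /eqP Eq] ->] vU.
have [-> _] := gmul_linear (bas p); rewrite memvD ?memvZ // gmul_bas //.
exact: H.
Qed.

(** The bit [g] is free exactly where both weights are 1/16; there it runs through the two values of
    the fusion product. *)
Lemma star_mkIS (d1 a1 d2 a2 g : bool) : g ==> d1 && d2 ->
  mkIS (d1 (+) d2) (a1 (+) a2 (+) g) \in star (mkIS d1 a1) (mkIS d2 a2).
Proof.
by case: d1; case: a1; case: d2; case: a2; case: g; rewrite //= !inE !IS_eqE.
Qed.

Lemma gmul_fusion la1 la2 (a b : T) : a \in gcomp S la1 -> b \in gcomp S la2 ->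
  gmul S a b \in (\sum_(la in lstar la1 la2) gcomp S la)%VS.
Proof.
apply: gmul_closed => p q pI qI <- <-; rewrite memvZ // memv_suml // => ga gaD.
rewrite memvZ //; set q' := (_, _).
have q'I : q' \in idx by apply: idx_add3.
apply: (subvP (sumv_sup (deg q') _ (subvv _))) (bas_gcomp C q'I).
rewrite inE; apply/forallP=> i; rewrite !ffunE /= !bitD; apply: star_mkIS.
by have := Deltad_sub i gaD; rewrite bitM.
Qed.

(** * The structure codes *)

Lemma code_DE : code_D S = D_G G.
Proof.
apply/setP=> d; rewrite inE; apply/existsP/idP => [[la /andP[/eqP <-]] | dD].
  rewrite gcomp_neq0 => /exists_inP[p pI]; rewrite -degE => /andP[/eqP <- _].
  exact: mem_Didx.
have pI : (d, 0) \in idx by rewrite mem_idx dD (C_G0 C).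
exists (deg (d, 0)); have := degE (d, 0) (deg (d, 0)); rewrite eqxx => /andP[/eqP <- _].
by rewrite eqxx gcomp_neq0; apply/exists_inP; exists (d, 0).
Qed.

Lemma code_CE : code_C S = perp r r (D_G G).
Proof.
have dp0 a : hprod (dperp 0) a = a by apply: bitP => i; bits.
apply/setP=> a; rewrite inE; apply/existsP/idP => [[la /and3P[/eqP d0 /eqP <-]] | aC].
  rewrite gcomp_neq0 => /exists_inP[p pI]; rewrite -degE => /andP[/eqP Ep /eqP <-].
  by rewrite Ep d0 dp0; apply: mem_Cidx.
have pI : (0, a) \in idx by rewrite mem_idx D_G0.
exists (deg (0, a)); have := degE (0, a) (deg (0, a)).
rewrite eqxx => /andP[/eqP <- /eqP <-].
by rewrite dp0 !eqxx gcomp_neq0; apply/exists_inP; exists (0, a).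
Qed.

(** On Delta^d the shift changes [ipow] and [eps] by the same sign (-1)^|a ga|, so the constant
    depends only on the coset of [b]. *)
Lemma cst_diag d a b : (d, a) \in idx -> a + b \in Deltad d ->
  cst C (d, a) (d, b) = cst C (d, a) (d, a).
Proof.
move=> pI; have -> : b = a + (a + b) by rewrite addrA addF2vv add0r.
rewrite addrA addF2vv add0r; move: (a + b) => ga gD.
have aC : a \in C_G G := mem_Cidx pI; have gaC := Deltad_C C G gD.
have bd : balanced d := balanced_D_G (mem_Didx pI); have bga := balanced_Deltad gD.
have [ea eg] := (C_G_even C G1 aC, C_G_even C G1 gaC).
rewrite /cst /= epsDr // (eps_gar _ _ _ aC gD) // [hprod d (a + ga)]hprodDr ipowD.
rewrite [ipow (hprod d ga)]ipow_balanced ?mulr1; last first.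
  by move=> k; rewrite !bitE bd bga.
have key : sg (hprod (hprod d (dperp d)) (hprod a (a + ga))) *
    sg (hprod (hprod d d) (a + ga)) * sg (hprod (hprod d a) (hprod d ga)) *
    sg (hprod a ga) =
    sg (hprod (hprod d (dperp d)) (hprod a a)) * sg (hprod (hprod d d) a).
  rewrite -!sgD; apply: sg_congr => k; rewrite !bitE !bd !bga.
  by have := Deltad_sub (rshift r k) gD; do ?[case: (bit _ _)].
by rewrite -key; ring.
Qed.

(** The only index of degree 0 is (0, 0). A term of the product reaches it only if the two d-vectors
    agree and the summation index is [a + b], which is the support condition of [phi]. *)
Lemma compo0_gmul p (x : T) : p \in idx ->
  compo (lam0 r r) (gmul S (bas p) x) = (cst C p p * phi p (vsval x)) *: gone S.
Proof.
case: p => d a pI; move: x.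
have [l _] := gmul_linear (bas (d, a)).
have cl := @compo_linear C r G (lam0 r r).
apply: bas_ext => [k x y | k x y | [d' b] qI].
- by rewrite l cl.
- by rewrite phi_val_linear mulrDr scalerDl scalerA mulrCA.
rewrite gmul_bas // phi_basE // /pmul /=.
rewrite (linear_scale _ _ cl) linear_sumZ //.
under eq_bigr => ga gaD.
  rewrite compo_bas ?(idx_add3 C Gsub pI qI gaD) // deg_eq0 xpair_eqE.
  over.
case: (d' =P d) => [Ed | nd] /=; last first.
  rewrite mulr0 scale0r big1 ?scaler0 // => ga _; rewrite ifN ?scaler0 //.
  apply/negP=> /andP[/eqP E _]; apply: nd.
  by rewrite -[d]addr0 -(addF2vv d') addrA E add0r.
rewrite Ed addF2vv eqxx /=.
have hd : hprod d d = d by apply: bitP => i; bits.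
rewrite hd; case: ifP => [abD | nab].
  rewrite (bigD1 (a + b)) //= addF2vv eqxx big1 => [|ga /andP[_ gab]].
    by rewrite addr0 scalerA cst_diag.
  rewrite ifN ?scaler0 //; apply: contra gab => /eqP E.
  by rewrite -[ga]add0r -(addF2vv (a + b)) -addrA E addr0.
rewrite mulr0 scale0r big1 ?scaler0 // => ga gaD; rewrite ifN ?scaler0 //.
apply/negP=> /eqP E; move: nab; suff -> : a + b = ga by rewrite gaD.
by rewrite -[a + b]addr0 -(addF2vv ga) addrA E add0r.
Qed.

Lemma S_G_simple : simple_alg S.
Proof.
move=> M [Mgr Mid]; have [->|M0] := eqVneq M 0%VS; [by left | right].
have compoM la x : x \in M -> compo la x \in M.
  rewrite {1}Mgr => /memv_sumP[v vM ->].
  under eq_bigr => mu _ do rewrite -[v mu]scale1r.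
  rewrite linear_sumZ; last exact: compo_linear.
  rewrite memv_suml // => mu _; rewrite scale1r.
  have := vM mu isT; rewrite memv_cap => /andP[vmM vmS].
  by rewrite (compo_gcomp r_gt0 G1 _ vmS); case: ifP; rewrite ?mem0v.
have oneM : gone S \in M.
  have x0 : vpick M != 0 by rewrite vpick0.
  have [p pI ph] := phi_sep r_gt0 G1 x0.
  have := compoM (lam0 r r) _ (Mid (bas p) _ (memv_pick M)).
  by rewrite compo0_gmul // rpredZeq mulf_eq0 (negbTE (cst_neq0 _ _ _)) (negbTE ph).
apply/eqP; rewrite eqEsubv subvf; apply/subvP=> x _.
by rewrite -(gmul1r x); apply: Mid.
Qed.

End Structure.

(** * The braiding identity at one coordinate *)

Section LocalIdentity.

(** This and the next two are evaluable copies of equality, fusion and A, for the exhaustive check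
    below. *)
Definition IS_eqb (a b : IS) : bool :=
  match a, b with
  | h0, h0 | hhalf, hhalf | h16, h16 => true
  | _, _ => false
  end.

Definition starb (a b h : IS) : bool :=
  match a, b with
  | h0, k | k, h0 => IS_eqb k h
  | hhalf, hhalf => IS_eqb h h0
  | hhalf, h16 | h16, hhalf => IS_eqb h h16
  | h16, h16 => IS_eqb h h0 || IS_eqb h hhalf
  end.

Definition Asetb (a0 a1 a2 a3 h : IS) : bool := starb a2 a3 h && starb a1 h a0.

Lemma mem_star a b h : (h \in star a b) = starb a b h.
Proof. by case: a; case: b; rewrite ?inE !IS_eqE; case: h. Qed.

Lemma mem_Aset a0 a1 a2 a3 h : (h \in Aset a0 a1 a2 a3) = Asetb a0 a1 a2 a3 h.
Proof. by rewrite inE !mem_star. Qed.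

(** Gaussian integers as pairs, so that the local identity is decided by computation. *)
Definition gauss : Type := (int * int)%type.
Definition gmulz (x y : gauss) : gauss :=
  (x.1 * y.1 - x.2 * y.2, x.1 * y.2 + x.2 * y.1).
Definition gaddz (x y : gauss) : gauss := (x.1 + y.1, x.2 + y.2).
Definition gconj (x : gauss) : gauss := (x.1, - x.2).
Definition gi (n : nat) : gauss := iter n (gmulz (0, 1)) (1, 0).

(* Twice the value of B, without the factor e^(-pi i/8) of the (1/16, 1/16)
   entries. *)
Definition Bz (b b' a0 a1 a2 a3 : IS) : gauss :=
  match a1, a2 with
  | h0, _ | _, h0 => (2, 0)
  | hhalf, hhalf => (-2, 0)
  | hhalf, h16 | h16, hhalf =>
      if IS_eqb a0 hhalf || IS_eqb a3 hhalf then (0, 2) else (0, -2)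
  | h16, h16 =>
      if ~~ IS_eqb a0 h16 && ~~ IS_eqb a3 h16 then
        (if IS_eqb a0 a3 then (2, 0) else (0, 2))
      else if IS_eqb a0 h16 && IS_eqb a3 h16 then
        (if IS_eqb b b' then (1, 1) else (1, -1))
      else (0, 0)
  end.

(* cst_exp, trip_exp, expL and expR are the contributions of one coordinate
   to exponents of i. *)
Definition cst_exp (d a d' a' : bool) : nat :=
  2 * (d && ~~ d' && (a && a')) + 2 * (d && d' && a') + (d && a').

(* For p . (q . s): the summation indices in Delta^(dq ds) and Delta^(dp (dq + ds))
   of the two products are the restrictions of a single x, because the two
   supports are disjoint. *)
Definition trip_exp (dp ap dq aq ds as_ x : bool) : nat :=
  let g := (dq && ds) && x in
  cst_exp dq aq ds as_ + 2 * (aq && g)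
  + cst_exp dp ap (dq (+) ds) (aq (+) as_ (+) g) + 2 * (ap && g)
  + 2 * (ap && (dp && (dq (+) ds) && x)).

(** Majority, written as the disjoint union of the supports of the two nested sums in d2 . (d1 .
    d3). Its symmetry gives both sides of (FA4) the same summation set. *)
Definition maj (d1 d2 d3 : bool) := (d1 && d3) (+) (d2 && (d1 (+) d3)).

Section Coordinate.
Variables (d1 d2 d3 a1 a2 a3 e : bool) (h' : IS).
Let deg0 x := mkIS (d1 (+) d2 (+) d3) (a1 (+) a2 (+) a3 (+) x).

Definition ok0 x := (x ==> maj d1 d2 d3) && IS_eqb (deg0 x) (deg0 e).

Definition okL x := ok0 x && IS_eqb (mkIS (d1 (+) d3) (a1 (+) a3 (+) (d1 && d3 && x))) h'.

Definition degR x := mkIS (d2 (+) d3) (a2 (+) a3 (+) (d2 && d3 && x)).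

Definition okR x :=
  ok0 x && Asetb (deg0 e) (mkIS d1 a1) (mkIS d2 a2) (mkIS d3 a3) (degR x).

(** The last two terms are the cost of exchanging the arguments in [eps a2 a1] and of moving from
    index [x] to the reference index [e]. *)
Definition expL x : nat :=
  trip_exp d2 a2 d1 a1 d3 a3 x + 2 * (a1 && a2)
  + 2 * ((a1 (+) a2 (+) a3) && (x (+) e)).

(* The local identity holds only with the sign (-1)^(d2 a1) inserted; it drops
   out globally because |d2 a1| is even. *)
Definition expR x : nat :=
  trip_exp d1 a1 d2 a2 d3 a3 x + 2 * (d2 && a1)
  + 2 * ((a1 (+) a2 (+) a3) && (x (+) e)).

(** A failed condition is encoded as the value 0, so that a product over coordinates vanishes unless
    the condition holds at each of them. *)
Definition Lz x : gauss := if okL x then gi (expL x) else (0, 0).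
Definition Rz x : gauss :=
  if okR x then gmulz (gi (expR x))
                      (Bz (degR x) h' (deg0 e) (mkIS d1 a1) (mkIS d2 a2) (mkIS d3 a3))
  else (0, 0).

Definition valid :=
  (e ==> maj d1 d2 d3) &&
  Asetb (deg0 e) (mkIS d2 a2) (mkIS d1 a1) (mkIS d3 a3) h'.

End Coordinate.

Definition allb (P : bool -> bool) := P false && P true.
Definition allIS (P : IS -> bool) := [&& P h0, P hhalf & P h16].

Lemma allbP P : allb P -> forall b, P b.
Proof. by case/andP=> ? ? []. Qed.

Lemma allISP P : allIS P -> forall h, P h.
Proof. by case/and3P=> ? ? ? []. Qed.

Definition geqb (x y : gauss) : bool := (x.1 == y.1) && (x.2 == y.2).

(** [x] and [e] are shared because the vectors they come from are diagonal. The factor 4 compensates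
    for the two factors [Bz], each of which is doubled. *)
Definition loc_check (d1 d2 d3 al1 al2 al3 ar1 ar2 ar3 e : bool) (hl hr : IS) : bool :=
  valid d1 d2 d3 al1 al2 al3 e hl && valid d1 d2 d3 ar1 ar2 ar3 e hr ==>
  let L x := gmulz (Lz d1 d2 d3 al1 al2 al3 e hl x)
                   (gconj (Lz d1 d2 d3 ar1 ar2 ar3 e hr x)) in
  let R x := gmulz (Rz d1 d2 d3 al1 al2 al3 e hl x)
                   (gconj (Rz d1 d2 d3 ar1 ar2 ar3 e hr x)) in
  geqb (gmulz (4, 0) (gaddz (L false) (L true))) (gaddz (R false) (R true)).

Lemma loc_checkP d1 d2 d3 al1 al2 al3 ar1 ar2 ar3 e hl hr :
  loc_check d1 d2 d3 al1 al2 al3 ar1 ar2 ar3 e hl hr.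
Proof.
have : allb (fun d1 => allb (fun d2 => allb (fun d3 => allb (fun al1 =>
  allb (fun al2 => allb (fun al3 => allb (fun ar1 => allb (fun ar2 =>
  allb (fun ar3 => allb (fun e => allIS (fun hl => allIS (fun hr =>
    loc_check d1 d2 d3 al1 al2 al3 ar1 ar2 ar3 e hl hr)))))))))))).
  by vm_compute.
move=> /allbP/(_ d1)/allbP/(_ d2)/allbP/(_ d3)/allbP/(_ al1)/allbP/(_ al2)/allbP/(_ al3).
by move=> /allbP/(_ ar1)/allbP/(_ ar2)/allbP/(_ ar3)/allbP/(_ e)/allISP/(_ hl)/allISP/(_ hr).
Qed.

Section Realisation.
Variable C : numClosedFieldType.

Definition gz (x : gauss) : C := x.1%:~R + 'i * x.2%:~R.

Lemma gzM x y : gz (gmulz x y) = gz x * gz y.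
Proof.
have i2 : ('i : C) * 'i = -1 by rewrite -expr2 sqrCi.
rewrite /gz /= rmorphB rmorphD /= !rmorphM /=.
move: (x.1%:~R) (x.2%:~R) (y.1%:~R) (y.2%:~R) => x1 x2 y1 y2.
transitivity (x1 * y1 + ('i * 'i) * (x2 * y2) + 'i * (x1 * y2 + x2 * y1)); last by ring.
by rewrite i2; ring.
Qed.

Lemma gzD x y : gz (gaddz x y) = gz x + gz y.
Proof. by rewrite /gz /= !rmorphD /= mulrDr; ring. Qed.

Lemma gz_conj x : gz (gconj x) = (gz x)^*.
Proof.
by rewrite /gz rmorphD rmorphM /= conjCi !rmorph_int rmorphN /= mulrN mulNr.
Qed.

Lemma gz_gi n : gz (gi n) = 'i ^+ n.
Proof.
elim: n => [|n IH]; first by rewrite /gz /= mulr0 addr0 expr0.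
by rewrite /gi iterS gzM -/(gi n) IH exprS /gz /= add0r mulr1.
Qed.

(* |e^(-pi i/8)| = 1 is all that is used of this constant. *)
Lemma zeta16_norm : zeta16 C * (zeta16 C)^* = 1.
Proof.
have s2 : sqrtC 2 ^+ 2 = 2 :> C by rewrite sqrtCK.
have s2ge : 0 <= sqrtC 2 :> C by rewrite sqrtC_ge0.
have le2 : sqrtC 2 <= 2 :> C.
  rewrite -[leRHS](@sqrCK C) // ler_sqrtC ?nnegrE //; last by rewrite exprn_ge0.
  by rewrite expr2 -{1}[2]mulr1 ler_pM2l // ler1n.
have u0 : 0 <= 2 + sqrtC 2 :> C by rewrite addr_ge0.
have v0 : 0 <= 2 - sqrtC 2 :> C by rewrite subr_ge0.
have ur : (sqrtC (2 + sqrtC 2) / 2 : C)^* = sqrtC (2 + sqrtC 2) / 2.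
  by apply/CrealP/ger0_real; rewrite divr_ge0 ?sqrtC_ge0.
have vr : (sqrtC (2 - sqrtC 2) / 2 : C)^* = sqrtC (2 - sqrtC 2) / 2.
  by apply/CrealP/ger0_real; rewrite divr_ge0 ?sqrtC_ge0.
rewrite /zeta16 rmorphB /= ur rmorphM /= vr conjCi mulNr opprK -subr_sqr.
rewrite !exprMn sqrCi !sqrtCK mulN1r opprK -mulrDl.
have -> : 2 + sqrtC 2 + (2 - sqrtC 2) = 2 * 2 :> C by ring.
by rewrite expr2 mulrACA divff ?mulr1 ?pnatr_eq0.
Qed.

Definition zfac (a1 a2 : IS) : C :=
  if IS_eqb a1 h16 && IS_eqb a2 h16 then zeta16 C else 1.

Lemma BvalE b b' a0 a1 a2 a3 :
  Bval C b b' a0 a1 a2 a3 = zfac a1 a2 * (gz (Bz b b' a0 a1 a2 a3) / 2).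
Proof.
have h2 : (2 : C) / 2 = 1 by rewrite divff ?pnatr_eq0.
have e20 : gz (2, 0) / 2 = 1 by rewrite /gz /= mulr0 addr0 h2.
have em20 : gz (-2, 0) / 2 = -1 by rewrite /gz /= mulr0 addr0 rmorphN /= mulNr h2.
have e02 : gz (0, 2) / 2 = 'i by rewrite /gz /= add0r -mulrA h2 mulr1.
have em02 : gz (0, -2) / 2 = - 'i by rewrite /gz /= add0r rmorphN /= mulrN mulNr -mulrA h2 mulr1.
have e11 : gz (1, 1) = 1 + 'i by rewrite /gz /= mulr1.
have e1m : gz (1, -1) = 1 - 'i by rewrite /gz /= rmorphN mulrN mulr1.
have e00 : gz (0, 0) / 2 = 0 by rewrite /gz /= mulr0 addr0 mul0r.
case: a1; case: a2; rewrite /= /zfac /= ?mul1r ?e20 ?em20 //.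
- by rewrite !IS_eqE; case: a0; case: a3; rewrite /= ?e02 ?em02.
- by rewrite !IS_eqE; case: a0; case: a3; rewrite /= ?e02 ?em02.
rewrite !IS_eqE; congr (_ * _).
by case: a0; case: a3; rewrite /= ?e20 ?e02 ?e00 //; case: b; case: b'; rewrite /= ?e11 ?e1m.
Qed.

End Realisation.

End LocalIdentity.

(** * The local identity with complex values *)

Section LocalComplex.
Variable C : numClosedFieldType.
Variables (d1 d2 d3 a1 a2 a3 e : bool) (h' : IS).

Definition Lloc x : C :=
  if okL d1 d2 d3 a1 a2 a3 e h' x then 'i ^+ expL d1 d2 d3 a1 a2 a3 e x else 0.

Definition Rloc x : C :=
  if okR d1 d2 d3 a1 a2 a3 e x then
    'i ^+ expR d1 d2 d3 a1 a2 a3 e x *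
    Bval C (degR d2 d3 a2 a3 x) h'
      (mkIS (d1 (+) d2 (+) d3) (a1 (+) a2 (+) a3 (+) e))
      (mkIS d1 a1) (mkIS d2 a2) (mkIS d3 a3)
  else 0.

Lemma gz00 : gz C (0, 0) = 0.
Proof. by rewrite /gz /= mulr0 addr0. Qed.

Lemma LlocE x : Lloc x = gz C (Lz d1 d2 d3 a1 a2 a3 e h' x).
Proof. by rewrite /Lloc /Lz; case: ifP; rewrite ?gz_gi ?gz00. Qed.

Lemma RlocE x : Rloc x =
  zfac C (mkIS d1 a1) (mkIS d2 a2) * (gz C (Rz d1 d2 d3 a1 a2 a3 e h' x) / 2).
Proof.
rewrite /Rloc /Rz; case: ifP => _; last by rewrite gz00 mul0r mulr0.
by rewrite BvalE gzM gz_gi -mulrA mulrCA.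
Qed.

End LocalComplex.

(* The d-bits of the left and right coordinates agree, so the constants
   e^(-pi i/8) and their conjugates cancel. *)
Lemma zfac_norm (C : numClosedFieldType) (d1 d2 al1 al2 ar1 ar2 : bool) :
  zfac C (mkIS d1 al1) (mkIS d2 al2) * (zfac C (mkIS d1 ar1) (mkIS d2 ar2))^* = 1.
Proof.
have E x y : zfac C (mkIS d1 x) (mkIS d2 y) = if d1 && d2 then zeta16 C else 1.
  by rewrite /zfac; case: d1; case: d2; case: x; case: y.
by rewrite !E; case: ifP; rewrite ?zeta16_norm // rmorph1 mulr1.
Qed.

Lemma local_identity (C : numClosedFieldType)
    (d1 d2 d3 al1 al2 al3 ar1 ar2 ar3 e : bool) (hl hr : IS) :
  valid d1 d2 d3 al1 al2 al3 e hl -> valid d1 d2 d3 ar1 ar2 ar3 e hr ->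
  \sum_(x : bool) Lloc C d1 d2 d3 al1 al2 al3 e hl x *
                  (Lloc C d1 d2 d3 ar1 ar2 ar3 e hr x)^* =
  \sum_(x : bool) Rloc C d1 d2 d3 al1 al2 al3 e hl x *
                  (Rloc C d1 d2 d3 ar1 ar2 ar3 e hr x)^*.
Proof.
move=> vl vr; have := loc_checkP d1 d2 d3 al1 al2 al3 ar1 ar2 ar3 e hl hr.
rewrite /loc_check vl vr /= => /andP[/eqP E1 /eqP E2].
set L := fun x => gmulz (Lz d1 d2 d3 al1 al2 al3 e hl x)
                        (gconj (Lz d1 d2 d3 ar1 ar2 ar3 e hr x)).
set R := fun x => gmulz (Rz d1 d2 d3 al1 al2 al3 e hl x)
                        (gconj (Rz d1 d2 d3 ar1 ar2 ar3 e hr x)).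
have key : gz C (gmulz (4, 0) (gaddz (L false) (L true))) = gz C (gaddz (R false) (R true)).
  by congr gz; apply: injective_projections.
have n4 : gz C (4, 0) = 4 by rewrite /gz /= mulr0 addr0.
rewrite gzM !gzD n4 in key.
have EL x : Lloc C d1 d2 d3 al1 al2 al3 e hl x * (Lloc C d1 d2 d3 ar1 ar2 ar3 e hr x)^* =
    gz C (L x) by rewrite !LlocE gzM gz_conj.
have ER x : Rloc C d1 d2 d3 al1 al2 al3 e hl x * (Rloc C d1 d2 d3 ar1 ar2 ar3 e hr x)^* =
    gz C (R x) / 4.
  rewrite !RlocE rmorphM /= mulrACA zfac_norm mul1r gzM gz_conj rmorphM /= fmorphV /= rmorph_nat.
  rewrite mulrACA -invfM; congr (_ * _^-1).
  by rewrite -natrM.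
under eq_bigr => x _ do rewrite EL.
under [RHS]eq_bigr => x _ do rewrite ER.
have n40 : (4 : C) != 0 by rewrite pnatr_eq0.
rewrite -mulr_suml; apply: (mulfI n40); rewrite mulrCA mulfV // mulr1.
by rewrite !big_bool /= [gz C (R true) + _]addrC -key addrC.
Qed.

(** * The braiding identity (FA4) *)

Section Associativity.
Variables (C : numClosedFieldType) (r : nat) (G : {set F2v r}).
Hypothesis r_gt0 : (0 < r)%N.
Hypothesis Gsub : zmod_closed G.
Hypothesis G1 : const_mx 1 \in G.
Implicit Types (a b c d ga : F2v (r + r)) (p q s : SGidx r).
Implicit Types f : {ffun 'I_r -> bool}.
Local Notation sg := (@sg C r).
Local Notation ipow := (@ipow C r).
Local Notation eps := (@eps C r).
Local Notation T := (SGspace C G).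
Local Notation S := (S_G C G).
Local Notation bas := (@bas C r G).
Local Notation idx := (idx G).

(** Indexing diagonal vectors by finite functions is the form in which [bigA_distr_bigA] exchanges
    sum and product. *)
Definition vf f : F2v (r + r) := Delta (\row_k (f k)%:R).

Lemma bit_vfl f k : bit (vf f) (lshift r k) = f k.
Proof. by rewrite bit_row_mxl /bit mxE; case: (f k). Qed.

Lemma bit_vfr f k : bit (vf f) (rshift r k) = f k.
Proof. by rewrite bit_row_mxr /bit mxE; case: (f k). Qed.

Lemma balanced_vf f : balanced (vf f).
Proof. by move=> k; rewrite bit_vfl bit_vfr. Qed.

(** By disjointness a pair (ga, ga0) is recovered from ga + ga0 by restriction to [M1] and [M2];
    left halves determine everything since all vectors are diagonal. *)
Lemma double_sum M1 M2 (F : F2v (r + r) -> F2v (r + r) -> T) :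
  balanced M1 -> balanced M2 -> (forall i, ~~ (bit M1 i && bit M2 i)) ->
  \sum_(ga in Deltad M1) \sum_(ga0 in Deltad M2) F ga ga0 =
  \sum_(f : {ffun 'I_r -> bool} | [forall k, f k ==> bit M1 (lshift r k) (+) bit M2 (lshift r k)])
    F (hprod M1 (vf f)) (hprod M2 (vf f)).
Proof.
move=> b1 b2 dis; rewrite pair_big /=.
pose h f := (hprod M1 (vf f), hprod M2 (vf f)).
pose h' (u : F2v (r + r) * F2v (r + r)) : {ffun 'I_r -> bool} :=
  [ffun k => bit u.1 (lshift r k) (+) bit u.2 (lshift r k)].
have sub M f : balanced M -> hprod M (vf f) \in Deltad M.
  move=> bM; apply: mem_Deltad => [k|i].
    by rewrite !bitM bM balanced_vf.
  by rewrite bitM; do 2?case: (bit _ _).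
rewrite (reindex_onto h h') /=.
  apply: eq_bigl => f; rewrite !sub //=; apply/eqP/forallP => [E k | H].
    rewrite -[in X in X ==> _]E ffunE /= !bitM bit_vfl.
    by do 3?case: (bit _ _); case: (f k).
  apply/ffunP=> k; have := H k; have := dis (lshift r k); rewrite ffunE /= !bitM bit_vfl.
  by case: (bit M1 _); case: (bit M2 _); case: (f k).
case=> ga ga0 /= /andP[g1 g2]; rewrite /h.
have E i : bit (vf (h' (ga, ga0))) i = bit ga i (+) bit ga0 i.
  rewrite -(splitK i); case: (split i) => k /=; rewrite ?bit_vfl ?bit_vfr ffunE //=.
  by rewrite (balanced_Deltad g1) (balanced_Deltad g2).
by congr (_, _); apply: bitP => i; rewrite bitM E; have := dis i;
  have := Deltad_sub i g1; have := Deltad_sub i g2; do ?[case: (bit _ _)].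
Qed.

Definition trip p q s ga ga0 : C :=
  cst C q s * sg (hprod q.2 ga) * (cst C p (q.1 + s.1, q.2 + s.2 + ga) * sg (hprod p.2 ga0)).

Lemma gmul_at_bas la p q : p \in idx -> q \in idx ->
  gmul_at S la (bas p) (bas q) =
  \sum_(ga in Deltad (hprod p.1 q.1))
    (if deg (p.1 + q.1, p.2 + q.2 + ga) == la
     then cst C p q * sg (hprod p.2 ga) else 0) *: bas (p.1 + q.1, p.2 + q.2 + ga).
Proof.
move=> pI qI; rewrite /gmul_at gmul_bas // /pmul.
have gl := @gproj_linear C r G la.
rewrite (linear_scale _ _ gl) linear_sumZ // scaler_sumr; apply: eq_bigr => ga gaD.
rewrite gproj_bas ?(idx_add3 C Gsub pI qI gaD) //.
by case: ifP; rewrite ?scalerA // !scaler0 scale0r.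
Qed.

Lemma gmul_at_linear la x : linear (fun y => gmul_at S la x y).
Proof.
move=> k y z; rewrite /gmul_at; have [-> _] := gmul_linear x.
exact: gproj_linear.
Qed.

Lemma gmul_at2 la0 la p q s : p \in idx -> q \in idx -> s \in idx ->
  gmul_at S la0 (bas p) (gmul_at S la (bas q) (bas s)) =
  \sum_(f : {ffun 'I_r -> bool} | [forall k, f k ==> bit (hprod q.1 s.1) (lshift r k)
                           (+) bit (hprod p.1 (q.1 + s.1)) (lshift r k)])
    (if deg (q.1 + s.1, q.2 + s.2 + hprod (hprod q.1 s.1) (vf f)) == la then
     if deg (p.1 + q.1 + s.1, p.2 + q.2 + s.2 + vf f) == la0 then
     trip p q s (hprod (hprod q.1 s.1) (vf f)) (hprod (hprod p.1 (q.1 + s.1)) (vf f))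
     else 0 else 0) *: bas (p.1 + q.1 + s.1, p.2 + q.2 + s.2 + vf f).
Proof.
move=> pI qI sI; rewrite gmul_at_bas // linear_sumZ; last exact: gmul_at_linear.
have bal (u v : F2v (r + r)) : balanced u -> balanced v -> balanced (hprod u v) /\ balanced (u + v).
  by move=> bu bv; split=> k; rewrite !bitE bu bv.
have [bp bq bs] := And3 (balanced_D_G (mem_Didx pI)) (balanced_D_G (mem_Didx qI))
  (balanced_D_G (mem_Didx sI)).
have [bqs bqs'] := bal _ _ bq bs; have [bp' _] := bal _ _ bp bqs'.
under eq_bigr => ga gaD.
  have I' := idx_add3 C Gsub qI sI gaD.
  rewrite gmul_at_bas // scaler_sumr.
  under eq_bigr => ga0 _ do rewrite scalerA /=.
  over.
rewrite (@double_sum (hprod q.1 s.1) (hprod p.1 (q.1 + s.1))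
  (fun ga ga0 => ((if deg (q.1 + s.1, q.2 + s.2 + ga) == la
      then cst C q s * sg (hprod q.2 ga) else 0) *
     (if deg (p.1 + (q.1 + s.1), p.2 + (q.2 + s.2 + ga) + ga0) == la0
      then cst C p (q.1 + s.1, q.2 + s.2 + ga) * sg (hprod p.2 ga0) else 0)) *:
    bas (p.1 + (q.1 + s.1), p.2 + (q.2 + s.2 + ga) + ga0))) //; last first.
  by move=> i; bits.
apply: eq_bigr => f /forallP Hf.
have -> : p.2 + (q.2 + s.2 + hprod (hprod q.1 s.1) (vf f)) +
    hprod (hprod p.1 (q.1 + s.1)) (vf f) = p.2 + q.2 + s.2 + vf f.
  have Hi i : bit (vf f) i ==> bit (hprod q.1 s.1) i (+) bit (hprod p.1 (q.1 + s.1)) i.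
    rewrite -(splitK i); case: (split i) => k /=; rewrite ?bit_vfl ?bit_vfr //.
    by rewrite -bqs -bp'.
  by apply: bitP => i; have := Hi i; bits.
rewrite [p.1 + (q.1 + s.1)]addrA; congr (_ *: _).
by case: ifP; case: ifP; rewrite ?mulr0 ?mul0r.
Qed.

(** Common form of all signs and powers of i: products add exponents, and equality is tested at each
    coordinate. *)
Definition iexp (n : 'I_(r + r) -> nat) : C := \prod_i cj i ('i ^+ n i).

Lemma iexpD n m : iexp n * iexp m = iexp (fun i => n i + m i)%N.
Proof. by rewrite -big_split; apply: eq_bigr => i _ /=; rewrite -cjM exprD. Qed.

Lemma sg_iexp v : sg v = iexp (fun i => 2 * bit v i)%N.
Proof.
apply: eq_bigr => i _; congr cj.
by case: (bit v i); rewrite ?muln1 ?muln0 ?sqrCi.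
Qed.

Lemma ipow_iexp v : ipow v = iexp (fun i => bit v i).
Proof. by apply: eq_bigr => i _; congr cj; case: (bit v i). Qed.

Lemma eq_iexp n m : (forall i, n i = m i) -> iexp n = iexp m.
Proof. by move=> E; apply: eq_bigr => i _; rewrite E. Qed.

Lemma cst_iexp p q : cst C p q =
  iexp (fun i => cst_exp (bit p.1 i) (bit p.2 i) (bit q.1 i) (bit q.2 i)) * eps p.2 q.2.
Proof.
rewrite /cst !sg_iexp ipow_iexp !iexpD; congr (_ * _); apply: eq_iexp => i.
by rewrite /cst_exp !bitE.
Qed.

(** The cocycle factor is independent of [v]: the inner index enters it only through [eps p.2 ga],
    which is a sign and accounts for the first term [2 * (ap && g)] of [trip_exp]. *)
Lemma trip_iexp p q s v : p \in idx -> q \in idx -> s \in idx -> balanced v ->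
  trip p q s (hprod (hprod q.1 s.1) v) (hprod (hprod p.1 (q.1 + s.1)) v) =
  eps q.2 s.2 * eps p.2 q.2 * eps p.2 s.2 *
  iexp (fun i => trip_exp (bit p.1 i) (bit p.2 i) (bit q.1 i) (bit q.2 i)
                          (bit s.1 i) (bit s.2 i) (bit v i)).
Proof.
move=> pI qI sI bv; set ga := hprod (hprod q.1 s.1) v.
have gaD : ga \in Deltad (hprod q.1 s.1).
  apply: mem_Deltad => [k|i]; last by rewrite /ga !bitM; do 3?case: (bit _ i).
  by rewrite !bitM bv (balanced_D_G (mem_Didx qI)) (balanced_D_G (mem_Didx sI)).
have [ep eq es] := And3 (C_G_even C G1 (mem_Cidx pI)) (C_G_even C G1 (mem_Cidx qI))
  (C_G_even C G1 (mem_Cidx sI)).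
have eg := C_G_even C G1 (Deltad_C C G gaD).
rewrite /trip !cst_iexp /= !epsDr ?sgD ?eq ?es ?mulr1 //.
rewrite (eps_gar _ _ _ (mem_Cidx pI) gaD) // !sg_iexp.
set e1 := eps q.2 s.2; set e2 := eps p.2 q.2; set e3 := eps p.2 s.2.
set x1 := iexp _; set x2 := iexp _; set x3 := iexp _; set x4 := iexp _; set x5 := iexp _.
rewrite [LHS](_ : _ = e1 * e2 * e3 * (x1 * x2 * x3 * x4 * x5)); last by ring.
congr (_ * _); rewrite !iexpD; apply: eq_iexp => i; rewrite /ga !bitE /trip_exp.
by [].
Qed.

(** * The braiding identity for three spanning vectors *)

Section ThreeElements.
Variables (d1 a1 d2 a2 d3 a3 : F2v (r + r)) (la' : lam r r) (fs : {ffun 'I_r -> bool}).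
Hypotheses (I1 : (d1, a1) \in idx) (I2 : (d2, a2) \in idx) (I3 : (d3, a3) \in idx).
Let b1 : balanced d1 := balanced_D_G (mem_Didx I1).
Let b2 : balanced d2 := balanced_D_G (mem_Didx I2).
Let b3 : balanced d3 := balanced_D_G (mem_Didx I3).
Let tot f : SGidx r := (d1 + d2 + d3, a1 + a2 + a3 + vf f).
Let la0 := deg (tot fs).

Definition majf f := [forall k, f k ==>
  maj (bit d1 (lshift r k)) (bit d2 (lshift r k)) (bit d3 (lshift r k))].

Hypothesis fs_maj : majf fs.
Hypothesis la'A : la' \in lA la0 (deg (d2, a2)) (deg (d1, a1)) (deg (d3, a3)).

Let L i x := Lloc C (bit d1 i) (bit d2 i) (bit d3 i) (bit a1 i) (bit a2 i) (bit a3 i)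
                  (bit (vf fs) i) (la' i) x.
Let R i x := Rloc C (bit d1 i) (bit d2 i) (bit d3 i) (bit a1 i) (bit a2 i) (bit a3 i)
                  (bit (vf fs) i) (la' i) x.

Lemma deg_eqE p la : (deg p == la) = [forall i, IS_eqb (mkIS (bit p.1 i) (bit p.2 i)) (la i)].
Proof.
have E (x y : IS) : IS_eqb x y = (x == y) by rewrite IS_eqE.
apply/eqP/forallP => [<- i | H]; first by rewrite E ffunE.
by apply/ffunP=> i; rewrite ffunE; apply/eqP; rewrite -E.
Qed.

Lemma majfE f : majf f = [forall i, bit (vf f) i ==> maj (bit d1 i) (bit d2 i) (bit d3 i)].
Proof.
apply/forallP/forallP => H x; last by have := H (lshift r x); rewrite bit_vfl.
rewrite -(splitK x); case: (split x) => k /=; rewrite ?bit_vfl ?bit_vfr //.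
by rewrite -b1 -b2 -b3.
Qed.

Lemma forall_and (P Q : pred 'I_(r + r)) :
  [forall i, P i] && [forall i, Q i] = [forall i, P i && Q i].
Proof.
apply/andP/forallP => [[/forallP HP /forallP HQ] i | H]; first by rewrite HP HQ.
by split; apply/forallP=> i; have /andP[] := H i.
Qed.

Lemma prod_cond (c : pred 'I_(r + r)) (F : 'I_(r + r) -> C) :
  \prod_i cj i (if c i then F i else 0) =
  if [forall i, c i] then \prod_i cj i (F i) else 0.
Proof.
case: ifPn => [/forallP H | /forallPn[i /negbTE ci]].
  by apply: eq_bigr => i _; rewrite H.
by rewrite (bigD1 i) //= ci cj0 mul0r.
Qed.

Let E0 : C := eps a2 a3 * eps a1 a2 * eps a1 a3.
Let transfer f := sg (hprod (a1 + a2 + a3) (vf f + vf fs)).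

Lemma left_local f :
  (if majf f then
   if deg (d1 + d3, a1 + a3 + hprod (hprod d1 d3) (vf f)) == la' then
   if deg (tot f) == la0 then
     trip (d2, a2) (d1, a1) (d3, a3) (hprod (hprod d1 d3) (vf f))
       (hprod (hprod d2 (d1 + d3)) (vf f)) * transfer f
   else 0 else 0 else 0) = E0 * \prod_i cj i (L i (bit (vf f) i)).
Proof.
rewrite /L /Lloc prod_cond -/(iexp _).
set c := [forall i, _].
have -> : c = majf f && ((deg (tot f) == la0) &&
   (deg (d1 + d3, a1 + a3 + hprod (hprod d1 d3) (vf f)) == la')).
  rewrite majfE !deg_eqE !forall_and; apply: eq_forallb => i.
  by rewrite /okL /ok0 ffunE /= !bitE -!andbA.
case: (majf f) => /=; last by rewrite mulr0.
case: (deg (tot f) == la0) => /=; last by rewrite mulr0 if_same.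
case: ifP => _; last by rewrite mulr0.
have [e1 e2] := (C_G_even C G1 (mem_Cidx I1), C_G_even C G1 (mem_Cidx I2)).
(* [E0] is the cocycle factor of the other side of (FA4); here [eps a1 a2] is exchanged for
   [eps a2 a1]. *)
have -> : E0 = eps a1 a3 * eps a2 a1 * eps a2 a3 * sg (hprod a1 a2).
  rewrite -(eps_sym r_gt0 e1 e2) /E0 /=.
  set x1 := eps a1 a3; set x2 := eps a2 a1; set x3 := eps a2 a3; set x4 := eps a1 a2.
  have x22 : x2 * x2 = 1 := eps_sqr _ _ _.
  transitivity (x3 * x4 * x1 * (x2 * x2)); first by rewrite x22 mulr1.
  by ring.
rewrite (trip_iexp I2 I1 I3 (@balanced_vf f)) /= -!mulrA; do 3!congr (_ * _).
set t := iexp _; set t' := iexp _.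
have -> : t' = t * sg (hprod a1 a2) * transfer f.
  by rewrite /transfer !sg_iexp !iexpD; apply: eq_iexp => i; rewrite /expL !bitE.
by rewrite !mulrA [sg _ * t]mulrC -[t * _ * _]mulrA sg_sqr mulr1.
Qed.

Lemma right_local f :
  (if majf f then
   if deg (tot f) == la0 then
   if deg (d2 + d3, a2 + a3 + hprod (hprod d2 d3) (vf f)) \in
      lA la0 (deg (d1, a1)) (deg (d2, a2)) (deg (d3, a3)) then
     lB C (deg (d2 + d3, a2 + a3 + hprod (hprod d2 d3) (vf f))) la' la0
       (deg (d1, a1)) (deg (d2, a2)) (deg (d3, a3)) *
     trip (d1, a1) (d2, a2) (d3, a3) (hprod (hprod d2 d3) (vf f))
       (hprod (hprod d1 (d2 + d3)) (vf f)) * transfer f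
   else 0 else 0 else 0) = E0 * \prod_i cj i (R i (bit (vf f) i)).
Proof.
rewrite /R /Rloc prod_cond.
set c := [forall i, _].
have -> : c = majf f && ((deg (tot f) == la0) &&
   (deg (d2 + d3, a2 + a3 + hprod (hprod d2 d3) (vf f)) \in
      lA la0 (deg (d1, a1)) (deg (d2, a2)) (deg (d3, a3)))).
  rewrite majfE deg_eqE inE !forall_and; apply: eq_forallb => i.
  by rewrite /okR /ok0 /degR mem_Aset !ffunE /= !bitE -!andbA.
case: (majf f) => /=; last by rewrite mulr0.
case: (deg (tot f) == la0) => /=; last by rewrite mulr0.
case: ifP => _; last by rewrite mulr0.
rewrite (trip_iexp I1 I2 I3 (@balanced_vf f)) /=.
under [in RHS]eq_bigr => i _ do rewrite cjM.
rewrite big_split /= -/(iexp _).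
have -> : lB C (deg (d2 + d3, a2 + a3 + hprod (hprod d2 d3) (vf f))) la' la0
    (deg (d1, a1)) (deg (d2, a2)) (deg (d3, a3)) =
  \prod_i cj i (Bval C (degR (bit d2 i) (bit d3 i) (bit a2 i) (bit a3 i) (bit (vf f) i))
    (la' i) (mkIS (bit d1 i (+) bit d2 i (+) bit d3 i)
                  (bit a1 i (+) bit a2 i (+) bit a3 i (+) bit (vf fs) i))
      (mkIS (bit d1 i) (bit a1 i)) (mkIS (bit d2 i) (bit a2 i)) (mkIS (bit d3 i) (bit a3 i))).
  by apply: eq_bigr => i _; rewrite /cj /degR !ffunE /= !bitE -?andbA.
set B := \prod_i _; rewrite -/E0.
(* Pays for the sign carried by [expR]: [a1] is orthogonal to [d2]. *)
have d2a1 : sg (hprod d2 a1) = 1.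
  by rewrite hprodC; apply: (elimT (C_GP C _ _) (mem_Cidx I1)); apply: (mem_Didx I2).
set t := iexp _; set t' := iexp _.
have -> : t' = t * transfer f.
  rewrite -[RHS]mulr1 -d2a1 /transfer !sg_iexp !iexpD; apply: eq_iexp => i.
  by rewrite /expR !bitE addnAC.
by ring.
Qed.

Lemma global_identity :
  \sum_f \prod_i cj i (L i (bit (vf f) i)) = \sum_f \prod_i cj i (R i (bit (vf f) i)).
Proof.
under eq_bigr => f _.
  rewrite prod_cj; under eq_bigr => k _ do rewrite bit_vfl bit_vfr.
  over.
under [RHS]eq_bigr => f _.
  rewrite prod_cj; under eq_bigr => k _ do rewrite bit_vfl bit_vfr.
  over.
rewrite -(bigA_distr_bigA (fun k x => L (lshift r k) x * (L (rshift r k) x)^*)).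
rewrite -(bigA_distr_bigA (fun k x => R (lshift r k) x * (R (rshift r k) x)^*)).
apply: eq_bigr => k _; rewrite /L /R !b1 !b2 !b3 (balanced_vf fs k).
have V i : valid (bit d1 i) (bit d2 i) (bit d3 i) (bit a1 i) (bit a2 i) (bit a3 i)
    (bit (vf fs) i) (la' i).
  move: fs_maj la'A; rewrite majfE inE => /forallP/(_ i) H /forallP/(_ i).
  by rewrite mem_Aset !ffunE /= !bitE /valid H.
apply: local_identity; last exact: V.
by have := V (lshift r k); rewrite b1 b2 b3 balanced_vf.
Qed.

Lemma bas_transfer f : (if majf f then if deg (tot f) == la0 then bas (tot f) else 0 else 0) =
  if majf f then if deg (tot f) == la0 then transfer f *: bas (tot fs) else 0 else 0.
Proof.
case: ifP => // mf; case: eqP => // Ed.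
have tI : tot fs \in idx.
  rewrite mem_idx !D_GD ?(mem_Didx I1) ?(mem_Didx I2) ?(mem_Didx I3) //=.
  rewrite !(C_GD C) ?(mem_Cidx I1) ?(mem_Cidx I2) ?(mem_Cidx I3) //.
  exact: C_G_Delta.
pose ga := vf f + vf fs.
have gaD : ga \in Deltad (d1 + d2 + d3).
  apply: mem_Deltad => [k|i]; first by rewrite !bitE !balanced_vf.
  (* Where the d-bit of the total is 0 the degree determines the c-bit, so equal degrees force the
     two indices to agree there. *)
  have := congr1 (fun la : lam r r => la i) Ed; rewrite !ffunE /= /ga !bitE.
  move: (_ (+) bit d3 i) (_ (+) bit a3 i) (bit (vf f) i) (bit (vf fs) i).
  by do 4!case.
have -> : tot f = ((tot fs).1, (tot fs).2 + ga).
  by rewrite /tot /ga /= addrA addrAC addF2vK.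
rewrite (bas_shift C r_gt0 G1 tI gaD) /=.
(* [bas_shift] gives the sign for [a1 + a2 + a3 + vf fs]; the extra overlap with [vf fs] is
   diagonal. *)
congr (_ *: _); rewrite /transfer -/ga; apply: sg_congr => k.
by rewrite !bitE !balanced_vf; do ?[case: (bit _ _)]; case: (fs k); case: (f k).
Qed.

Lemma associativity_tot :
  gmul_at S la0 (bas (d2, a2)) (gmul_at S la' (bas (d1, a1)) (bas (d3, a3))) =
  \sum_(la in lA la0 (deg (d1, a1)) (deg (d2, a2)) (deg (d3, a3)))
     lB C la la' la0 (deg (d1, a1)) (deg (d2, a2)) (deg (d3, a3)) *:
     gmul_at S la0 (bas (d1, a1)) (gmul_at S la (bas (d2, a2)) (bas (d3, a3))).
Proof.
have majE f (u1 u2 u3 : F2v (r + r)) : [forall k, f k ==> bit (hprod u1 u3) (lshift r k)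
    (+) bit (hprod u2 (u1 + u3)) (lshift r k)] =
  [forall k, f k ==> maj (bit u1 (lshift r k)) (bit u2 (lshift r k)) (bit u3 (lshift r k))].
  by apply: eq_forallb => k; rewrite /maj !bitE.
have maj12 f : [forall k, f k ==> maj (bit d2 (lshift r k)) (bit d1 (lshift r k))
    (bit d3 (lshift r k))] = majf f.
  apply: eq_forallb => k; congr (_ ==> _); rewrite /maj.
  by do 3!case: (bit _ _).
transitivity ((\sum_f E0 * \prod_i cj i (L i (bit (vf f) i))) *: bas (tot fs)).
  rewrite gmul_at2 //= scaler_suml big_mkcond; apply: eq_bigr => f _.
  rewrite majE -left_local [d2 + d1]addrC [a2 + a1]addrC -/(majf f) -/(tot f).
  have := bas_transfer f; case: (majf f); rewrite ?scale0r //.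
  case: (deg (tot f) == la0); last by rewrite if_same !scale0r.
  by move=> ->; rewrite scalerA; case: ifP; rewrite ?mul0r.
rewrite -mulr_sumr global_identity mulr_sumr.
under [RHS]eq_bigr => la _.
  rewrite gmul_at2 //= scaler_sumr.
  over.
rewrite exchange_big /= scaler_suml [RHS]big_mkcond; apply: eq_bigr => f _.
rewrite majE maj12 -right_local.
have := bas_transfer f; case: (majf f); rewrite ?scale0r //=.
rewrite -/(tot f); case: (deg (tot f) == la0) => bt; last first.
  by rewrite scale0r big1 // => la _; rewrite if_same scale0r scaler0.
(* For fixed [f] the inner product has the single intermediate degree [la], so at most one term of
   the sum over degrees survives. *)
set la := deg (d2 + d3, _); case: ifP => laA; last first.
  rewrite scale0r big1 // => mu muA; rewrite ifN ?scale0r ?scaler0 //.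
  by apply: contraTneq muA => <-; rewrite laA.
rewrite (bigD1 la) //= eqxx big1 => [|mu /andP[_ mula]]; last first.
  by rewrite eq_sym (negbTE mula) scale0r scaler0.
by rewrite addr0 bt !scalerA mulrA.
Qed.

End ThreeElements.

Lemma associativity_bas p1 p2 p3 la0 la' :
  p1 \in idx -> p2 \in idx -> p3 \in idx -> la' \in lA la0 (deg p2) (deg p1) (deg p3) ->
  gmul_at S la0 (bas p2) (gmul_at S la' (bas p1) (bas p3)) =
  \sum_(la in lA la0 (deg p1) (deg p2) (deg p3))
     lB C la la' la0 (deg p1) (deg p2) (deg p3) *:
     gmul_at S la0 (bas p1) (gmul_at S la (bas p2) (bas p3)).
Proof.
case: p1 p2 p3 => d1 a1 [d2 a2] [d3 a3] I1 I2 I3 la'A.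
have maj12 f : [forall k, f k ==> bit (hprod d2 d3) (lshift r k)
    (+) bit (hprod d1 (d2 + d3)) (lshift r k)] = majf d1 d2 d3 f.
  apply: eq_forallb => k; congr (_ ==> _); rewrite !bitE /maj.
  by do 3!case: (bit _ _).
have maj21 f : [forall k, f k ==> bit (hprod d1 d3) (lshift r k)
    (+) bit (hprod d2 (d1 + d3)) (lshift r k)] = majf d1 d2 d3 f.
  by apply: eq_forallb => k; rewrite /maj !bitE.
(* An admissible index in degree [la0] serves as reference; without one every coefficient on both
   sides is 0. *)
have [[fs /andP[mfs /eqP E]] | H] := altP (@existsP _
    (fun f => majf d1 d2 d3 f && (deg (d1 + d2 + d3, a1 + a2 + a3 + vf f) == la0))).
  by rewrite -E in la'A *; apply: associativity_tot.
have nE f : majf d1 d2 d3 f -> (deg (d1 + d2 + d3, a1 + a2 + a3 + vf f) == la0) = false.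
  by move=> mf; apply/negP=> E; case/existsP: H; exists f; rewrite mf.
rewrite gmul_at2 // big1 => [|f]; last first.
  by rewrite maj21 => mf; rewrite [_ + d1]addrC [_ + a1]addrC nE // if_same scale0r.
rewrite big1 // => la _; rewrite gmul_at2 // big1 ?scaler0 // => f.
by rewrite maj12 => mf; rewrite nE // if_same scale0r.
Qed.

(** * Extension to homogeneous elements by linearity *)

Lemma linear_sum (U : lmodType C) (I : finType) (P : pred I) (c : I -> C) (F : I -> T -> U) :
  (forall i, linear (F i)) -> linear (fun x => \sum_(i | P i) c i *: F i x).
Proof.
move=> lF k x y; rewrite scaler_sumr -big_split; apply: eq_bigr => i _ /=.
by rewrite lF scalerDr !scalerA mulrC.
Qed.

Lemma gmul_at_linearl la x : linear (fun y => gmul_at S la y x).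
Proof.
move=> k y z; rewrite /gmul_at; have [_ ->] := gmul_linear x.
exact: gproj_linear.
Qed.

Lemma associativity la0 la1 la2 la3 (x1 x2 x3 : T) la' :
  x1 \in gcomp S la1 -> x2 \in gcomp S la2 -> x3 \in gcomp S la3 ->
  la' \in lA la0 la2 la1 la3 ->
  gmul_at S la0 x2 (gmul_at S la' x1 x3) =
  \sum_(la in lA la0 la1 la2 la3)
     lB C la la' la0 la1 la2 la3 *: gmul_at S la0 x1 (gmul_at S la x2 x3).
Proof.
move=> x1S x2S x3S la'A; move: x1 x1S; apply: gcomp_ext => [k y z | | p1 I1 D1].
- by rewrite gmul_at_linearl gmul_at_linear.
- by apply: linear_sum => la; apply: gmul_at_linearl.
move: x2 x2S; apply: gcomp_ext => [|| p2 I2 D2]; first exact: gmul_at_linearl.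
  by apply: linear_sum => la k y z; rewrite gmul_at_linearl gmul_at_linear.
move: x3 x3S; apply: gcomp_ext => [k y z || p3 I3 D3].
- by rewrite !gmul_at_linear.
- by apply: linear_sum => la k y z; rewrite !gmul_at_linear.
by subst la1 la2 la3; apply: associativity_bas.
Qed.

End Associativity.

Theorem theorem2 (C : numClosedFieldType) (r : nat) (G : {set 'rV['F_2]_r}) :
  (1 <= r)%N ->
  zmod_closed G ->
  const_mx 1 \in G ->
  framed_algebra (S_G C G) /\ simple_alg (S_G C G)
  /\ code_D (S_G C G) = D_G G
  /\ code_C (S_G C G) = perp r r (D_G G).
Proof.
move=> r_gt0 Gsub G1.
split; last by split; [apply: S_G_simple | split; [apply: code_DE | apply: code_CE]].
split; first by split; [apply: grading_direct | apply: grading_full].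
split=> [k x y z|]; first by have [l1 l2] := @gmul_linear C r G z; split; [apply: l2 | apply: l1].
split=> [la|]; first exact: gcomp_int.
split.
  split; first exact: (bas_neq0 C r_gt0 G1 (idx0 C Gsub)).
  split; first exact: gcomp_lam0.
  by move=> x; split; [apply: gmul1l | apply: gmul1r].
split=> [la1 la2 x y|]; first exact: gmul_fusion.
by move=> la0 la1 la2 la3 x1 x2 x3 la'; apply: associativity.
Qed.
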